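(* Let $m\ge0$ be an integer, $f(z)=\sum_{n\ge m}a_nz^n$, $g(z)=\sum_{n\ge m}b_nz^n$, let $h(z)=\sum_{n\ge m}c_nz^n$, and let $T=A^{m,-m}_h$, where $|c_n|\le|c_{n+1}|$ for all $n\ge m$. Suppose that $Tf$ and $Tg$ are analytic in $\mathbb{D}$. If $Tf\prec Tg$ in $\mathbb{D}$, then $$M_rf\le M_r(Tg),\qquad 0\le r\le R_{T\to id}.$$
   Context: $\mathbb{D}$ is the open unit disk and $\|u\|_\infty=\sup_{z\in\mathbb{D}}|u(z)|$. For a power series $u(z)=\sum_nu_nz^n$, the majorant series is $M_ru=\sum_n|u_n|r^n\in[0,\infty]$. All power series $f=\sum_{n\ge m}a_nz^n$ considered converge in some disk $t\mathbb{D}$, $t>0$, and $$Tf(z)=A^{m,-m}_hf(z)=z^{-m}(h\ast f)(z)=\sum_{n\ge m}c_na_nz^{n-m};$$ in particular $M_r(Tg)=\sum_{n\ge m}|c_nb_n|r^{n-m}$. Subordination: $F\prec G$ in $\mathbb{D}$ means that there is an analytic function $\omega$ on $\mathbb{D}$ with $|\omega(z)|\le1$, $\omega(0)=0$ and $F(z)=G(\omega(z))$ for $z\in\mathbb{D}$. The Bohr radius $R_{T\to id}$ is the maximal $R\in[0,\infty)$ such that for every $f=\sum_{n\ge m}a_nz^n$ for which $Tf$ converges in $\mathbb{D}$ and $\|Tf\|_\infty\le1$, one has $M_rf\le1$ for all $0\le r\le R$. It is tacitly assumed that such an $R$ exists (i.e. that $R=0$ is admissible). *)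

(* Defs.v *)
(* Stdlib world: Stdlib reals, complex numbers and series from Coquelicot. *)
From Stdlib Require Export Reals.
From Coquelicot Require Export Coquelicot.
Open Scope R_scope.

(* A power series is identified with its sequence of coefficients; [pseries_from m a] says that
   a = sum_{n >= m} a_n z^n converges in some disk t D with t > 0. *)
Definition pseries_from (m : nat) (a : nat -> C) : Prop :=
  (forall n : nat, (n < m)%nat -> a n = RtoC 0) /\
  exists t : R, 0 < t /\ forall z : C, Cmod z < t -> ex_pseries a z.

Definition converges_in_disk (u : nat -> C) : Prop :=
  forall z : C, Cmod z < 1 -> ex_pseries u z.

(* Meaningful only where the series converges. *)
Definition psum (u : nat -> C) (z : C) : C :=
  @iota C_CompleteNormedModule (fun l => is_pseries u z l).

Definition hadamard (c a : nat -> C) : nat -> C := fun n => Cmult (c n) (a n).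

(* The operator z^{-m} (h * .) where h = sum c_n z^n. *)
Definition A_op (m : nat) (c a : nat -> C) : nat -> C := fun k => hadamard c a (k + m)%nat.

(* The supremum of |F| over the unit disk, in [0, +oo]. *)
Definition disk_norm (F : C -> C) : Rbar :=
  Lub_Rbar (fun x : R => exists z : C, Cmod z < 1 /\ x = Cmod (F z)).

(* Limit in [0, +oo] of nondecreasing partial sums (for r >= 0). *)
Definition majorant (r : R) (u : nat -> C) : Rbar :=
  Lim_seq (fun N => sum_n (fun n => Cmod (u n) * r ^ n) N).

Definition analytic_at (F : C -> C) (z0 : C) : Prop :=
  exists (u : nat -> C) (t : R), 0 < t /\
    forall z : C, Cmod (Cminus z z0) < t -> is_pseries u (Cminus z z0) (F z).

Definition analytic_in_disk (F : C -> C) : Prop :=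
  forall z0 : C, Cmod z0 < 1 -> analytic_at F z0.

Definition subordinate (F G : C -> C) : Prop :=
  exists omega : C -> C,
    analytic_in_disk omega /\
    (forall z : C, Cmod z < 1 -> Cmod (omega z) <= 1) /\
    omega (RtoC 0) = RtoC 0 /\
    (forall z : C, Cmod z < 1 -> F z = G (omega z)).

Definition bohr_admissible (m : nat) (c : nat -> C) (R0 : R) : Prop :=
  0 <= R0 /\
  forall f : nat -> C, pseries_from m f ->
    converges_in_disk (A_op m c f) ->
    Rbar_le (disk_norm (psum (A_op m c f))) 1 ->
    forall r : R, 0 <= r <= R0 -> Rbar_le (majorant r f) 1.

(* R0 is the Bohr radius R_{T -> id} of T = A_op m c, i.e. the greatest admissible number. *)
Definition is_bohr_radius (m : nat) (c : nat -> C) (R0 : R) : Prop :=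
  bohr_admissible m c R0 /\ forall R1 : R, bohr_admissible m c R1 -> R1 <= R0.

(* Main.v *)
Require Import Defs.
From Stdlib Require Import Lra Lia Psatz Classical ClassicalEpsilon FunctionalExtensionality.

(** Write d_k for the coefficients of Tg, so that Tf = sum_k d_k omega^k with omega the subordinating
    function. By Schwarz's lemma omega = z phi with |phi| <= 1 on the disk, hence omega^k = z^k phi^k with
    phi^k bounded by 1. Let phi^k = sum_j q_{k,j} z^j. Applying the inverse of T,
      a_(m+j) = sum_(k <= j) d_k q_{k,j-k} / c_(m+j).
    Because |c_n| is nondecreasing, 1 / |c_(m+j)| <= 1 / |c_(m+j-k)|, so that
      M_r f <= sum_k |d_k| r^k * (sum_i |q_{k,i}| r^(m+i) / |c_(m+i)|).
    The inner sum is the majorant series of the preimage of phi^k under T, which is at most 1 for r up to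
    the Bohr radius ([bohr_preimage]). The division is legitimate unless c_m = 0; in that case the Bohr
    radius is 0 and m > 0 ([bohr_zero_lead]), so that r and M_r f vanish.

    Since omega is only locally the sum of power series, a form of Cauchy's theorem is needed: its Taylor
    series at 0, and those of its powers, have coefficients bounded by 1 ([bounded_coeff]). The argument
    uses no integral. The average over N equally spaced points of a circle extracts Taylor coefficients as
    N grows ([circle_mean_coeff]), and it is asymptotically independent of the radius
    ([circle_mean_radius]): the Cauchy-Riemann equation turns radial increments into angular ones, which
    cancel around the circle. The coefficient bound for all powers of omega gives [schwarz] without the
    maximum principle, and [composition_coeff] identifies the coefficients of a composition by comparing
    orders of vanishing at 0. *)

(** * Finite sums *)

(** The bound is exclusive, unlike that of [sum_n], so that splitting a sum and shifting its index
    need no correction by one. *)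
Fixpoint csum (u : nat -> C) (n : nat) : C :=
  match n with O => RtoC 0 | S k => (csum u k + u k)%C end.

Fixpoint rsum (u : nat -> R) (n : nat) : R :=
  match n with O => 0 | S k => rsum u k + u k end.

Lemma csum_ext (u v : nat -> C) (n : nat) :
  (forall k, (k < n)%nat -> u k = v k) -> csum u n = csum v n.
Proof.
  induction n as [|n IH]; intros H; simpl; [easy|].
  rewrite IH, H; [easy | lia | intros; apply H; lia].
Qed.

Lemma csum_plus (u v : nat -> C) (n : nat) :
  csum (fun k => u k + v k)%C n = (csum u n + csum v n)%C.
Proof. induction n as [|n IH]; simpl; [|rewrite IH]; ring. Qed.

Lemma csum_scal (x : C) (u : nat -> C) (n : nat) :
  csum (fun k => x * u k)%C n = (x * csum u n)%C.
Proof. induction n as [|n IH]; simpl; [|rewrite IH]; ring. Qed.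

Lemma csum_zero (u : nat -> C) (n : nat) :
  (forall k, (k < n)%nat -> u k = RtoC 0) -> csum u n = RtoC 0.
Proof.
  induction n as [|n IH]; intros H; simpl; [easy|].
  rewrite IH, H; [ring | lia | intros; apply H; lia].
Qed.

Lemma csum_add (u : nat -> C) (n p : nat) :
  csum u (n + p) = (csum u n + csum (fun k => u (n + k)%nat) p)%C.
Proof.
  induction p as [|p IH]; simpl; [rewrite Nat.add_0_r; ring|].
  rewrite Nat.add_succ_r; simpl; rewrite IH; ring.
Qed.

Lemma csum_swap (u : nat -> nat -> C) (n p : nat) :
  csum (fun i => csum (u i) p) n = csum (fun j => csum (fun i => u i j) n) p.
Proof.
  induction n as [|n IH]; simpl.
  - symmetry; now apply csum_zero.
  - rewrite IH; symmetry; apply csum_plus.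
Qed.

Lemma rsum_le (u v : nat -> R) (n : nat) :
  (forall k, (k < n)%nat -> u k <= v k) -> rsum u n <= rsum v n.
Proof.
  induction n as [|n IH]; intros H; simpl; [lra|].
  apply Rplus_le_compat; [apply IH; intros; apply H; lia | apply H; lia].
Qed.

Lemma rsum_scal (x : R) (u : nat -> R) (n : nat) :
  rsum (fun k => x * u k) n = x * rsum u n.
Proof. induction n as [|n IH]; simpl; [|rewrite IH]; ring. Qed.

Lemma rsum_plus (u v : nat -> R) (n : nat) :
  rsum (fun k => u k + v k) n = rsum u n + rsum v n.
Proof. induction n as [|n IH]; simpl; [|rewrite IH]; ring. Qed.

Lemma rsum_swap (u : nat -> nat -> R) (n p : nat) :
  rsum (fun i => rsum (u i) p) n = rsum (fun j => rsum (fun i => u i j) n) p.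
Proof.
  induction n as [|n IH]; simpl.
  - induction p as [|p IH]; simpl; [easy | rewrite <- IH; ring].
  - rewrite IH; symmetry; apply rsum_plus.
Qed.

Lemma rsum_const (x : R) (n : nat) : rsum (fun _ => x) n = INR n * x.
Proof.
  induction n as [|n IH]; [simpl; ring|].
  rewrite S_INR; simpl; rewrite IH; ring.
Qed.

Lemma rsum_add (u : nat -> R) (n p : nat) :
  rsum u (n + p) = rsum u n + rsum (fun k => u (n + k)%nat) p.
Proof.
  induction p as [|p IH]; simpl; [rewrite Nat.add_0_r; ring|].
  rewrite Nat.add_succ_r; simpl; rewrite IH; ring.
Qed.

Lemma rsum_nonneg (u : nat -> R) (n : nat) :
  (forall k, (k < n)%nat -> 0 <= u k) -> 0 <= rsum u n.
Proof.
  intros H; rewrite <- (Rmult_0_r (INR n)), <- rsum_const.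
  now apply rsum_le.
Qed.

Lemma rsum_mono (u : nat -> R) (n p : nat) :
  (forall k, 0 <= u k) -> (n <= p)%nat -> rsum u n <= rsum u p.
Proof.
  intros H Hnp; replace p with (n + (p - n))%nat by lia.
  rewrite rsum_add.
  assert (0 <= rsum (fun k => u (n + k)%nat) (p - n)) by (apply rsum_nonneg; auto).
  lra.
Qed.

Lemma rsum_ge_term (u : nat -> R) (n : nat) :
  (forall k, 0 <= u k) -> u n <= rsum u (S n).
Proof.
  intros H; simpl.
  assert (0 <= rsum u n) by (apply rsum_nonneg; auto); lra.
Qed.

Lemma Cmod_csum (u : nat -> C) (n : nat) :
  Cmod (csum u n) <= rsum (fun k => Cmod (u k)) n.
Proof.
  induction n as [|n IH]; simpl; [rewrite Cmod_0; lra|].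
  eapply Rle_trans; [apply Cmod_triangle | lra].
Qed.

Lemma rsum_geom (q : R) (n : nat) : 0 <= q < 1 -> rsum (fun k => q ^ k) n <= / (1 - q).
Proof.
  intros Hq.
  assert (E : rsum (fun k => q ^ k) n = (1 - q ^ n) * / (1 - q)).
  { induction n as [|n IH]; simpl; [field; lra | rewrite IH; field; lra]. }
  rewrite E; apply Rle_trans with (1 * / (1 - q)); [|lra].
  apply Rmult_le_compat_r; [left; apply Rinv_0_lt_compat; lra|].
  assert (0 <= q ^ n) by (apply pow_le; lra); lra.
Qed.

(** If every tail had a block exceeding eps, then j successive blocks would add up to j * eps, beyond M
    for j large. *)
Lemma rsum_tail (u : nat -> R) (M eps : R) :
  (forall k, 0 <= u k) -> (forall n, rsum u n <= M) -> 0 < eps ->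
  exists N, forall p, rsum (fun k => u (N + k)%nat) p <= eps.
Proof.
  intros Hu HM Heps; apply NNPP; intros Hno.
  assert (H : forall j, exists N, INR j * eps <= rsum u N).
  { induction j as [|j [N HN]]; [exists O; simpl; lra|].
    apply NNPP; intros Hj; apply Hno; exists N; intros p.
    apply Rnot_lt_le; intros Hp; apply Hj; exists (N + p)%nat.
    rewrite rsum_add, S_INR; lra. }
  destruct (nfloor_ex (M / eps + 1)) as [j Hj].
  { assert (0 <= M) by exact (HM O).
    assert (0 <= M / eps) by (apply Rdiv_le_0_compat; lra); lra. }
  destruct (H j) as [N HN]; specialize (HM N).
  assert (M / eps < INR j) by lra.
  apply Rlt_div_l in H0; lra.
Qed.

(** * Complex series and Cauchy products *)

(** The metric form of [is_series] over C: estimates of [Cmod] apply to it directly, whereas the filters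
    of [is_series] are those of the product topology. *)
Definition has_sum (u : nat -> C) (l : C) : Prop :=
  forall eps, 0 < eps -> exists N, forall n, (N <= n)%nat -> Cmod (csum u n - l)%C < eps.

Lemma sum_n_csum (u : nat -> C) (n : nat) :
  @sum_n (NormedModule.AbelianMonoid C_AbsRing C_NormedModule) u n = csum u (S n).
Proof.
  induction n as [|n IH].
  - rewrite sum_O; simpl; ring.
  - rewrite sum_Sn, IH; reflexivity.
Qed.

Lemma sum_n_rsum (u : nat -> R) (n : nat) : sum_n u n = rsum u (S n).
Proof.
  induction n as [|n IH].
  - rewrite sum_O; simpl; ring.
  - rewrite sum_Sn, IH; reflexivity.
Qed.

Lemma is_series_has_sum (u : nat -> C) (l : C) :
  @is_series C_AbsRing C_NormedModule u l <-> has_sum u l.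
Proof.
  unfold is_series; split; intros H.
  - intros eps Heps.
    destruct (H (fun y => Cmod (y - l)%C < eps)) as [N HN].
    + apply (locally_le_locally_norm l); exists (mkposreal eps Heps).
      intros y Hy; exact Hy.
    + exists (S N); intros n Hn.
      destruct n as [|n]; [lia|].
      rewrite <- sum_n_csum; apply HN; lia.
  - intros P HP; apply (locally_norm_le_locally l) in HP; destruct HP as [eps HP].
    destruct (H eps (cond_pos eps)) as [N HN].
    exists N; intros n Hn; apply HP.
    change (Cmod (@sum_n (NormedModule.AbelianMonoid C_AbsRing C_NormedModule) u n - l)%C < eps).
    rewrite sum_n_csum; apply HN; lia.
Qed.

Lemma pow_n_Cpow (z : C) (n : nat) : @pow_n C_Ring z n = (z ^ n)%C.
Proof. induction n as [|n IH]; simpl; [reflexivity|]. rewrite IH; reflexivity. Qed.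

Lemma has_sum_ext (u v : nat -> C) (l : C) :
  (forall n, u n = v n) -> has_sum u l -> has_sum v l.
Proof.
  intros E H eps Heps; destruct (H eps Heps) as [N HN]; exists N; intros n Hn.
  rewrite <- (csum_ext u v); auto.
Qed.

Lemma is_pseries_has_sum (u : nat -> C) (z l : C) :
  @is_pseries C_AbsRing C_NormedModule u z l <-> has_sum (fun k => u k * z ^ k)%C l.
Proof.
  unfold is_pseries; rewrite is_series_has_sum.
  assert (E : forall k, @scal C_Ring C_NormedModule (pow_n z k) (u k) = (u k * z ^ k)%C).
  { intros k; change (@pow_n C_Ring z k * u k = u k * z ^ k)%C.
    rewrite (pow_n_Cpow z k); ring. }
  split; apply has_sum_ext; intros k; [exact (E k) | exact (eq_sym (E k))].
Qed.

Lemma has_sum_unique (u : nat -> C) (l l' : C) : has_sum u l -> has_sum u l' -> l = l'.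
Proof.
  intros H H'; apply NNPP; intros Hne.
  assert (Hp : 0 < Cmod (l - l')%C).
  { apply Cmod_gt_0; intros E; apply Hne.
    replace l with (l' + (l - l'))%C by ring; rewrite E; ring. }
  destruct (H (Cmod (l - l')%C / 2)) as [N HN]; [lra|].
  destruct (H' (Cmod (l - l')%C / 2)) as [N' HN']; [lra|].
  specialize (HN (max N N') (Nat.le_max_l _ _)); specialize (HN' (max N N') (Nat.le_max_r _ _)).
  pose proof (Cmod_triangle (csum u (max N N') - l') (- (csum u (max N N') - l))) as T.
  rewrite Cmod_opp in T.
  replace (csum u (Init.Nat.max N N') - l' + - (csum u (Init.Nat.max N N') - l))%C
    with (l - l')%C in T by ring.
  lra.
Qed.

Lemma has_sum_plus (u v : nat -> C) (l l' : C) :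
  has_sum u l -> has_sum v l' -> has_sum (fun k => u k + v k)%C (l + l')%C.
Proof.
  intros H H' eps Heps.
  destruct (H (eps / 2)) as [N HN]; [lra|]; destruct (H' (eps / 2)) as [N' HN']; [lra|].
  exists (max N N'); intros n Hn.
  specialize (HN n ltac:(lia)); specialize (HN' n ltac:(lia)).
  rewrite csum_plus.
  replace (csum u n + csum v n - (l + l'))%C with ((csum u n - l) + (csum v n - l'))%C by ring.
  eapply Rle_lt_trans; [apply Cmod_triangle | lra].
Qed.

Lemma has_sum_scal (x : C) (u : nat -> C) (l : C) :
  has_sum u l -> has_sum (fun k => x * u k)%C (x * l)%C.
Proof.
  intros H eps Heps.
  pose proof (Cmod_ge_0 x) as Hx.
  destruct (H (eps / (Cmod x + 1))) as [N HN]; [apply Rdiv_lt_0_compat; lra|].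
  exists N; intros n Hn; specialize (HN n Hn).
  rewrite csum_scal.
  replace (x * csum u n - x * l)%C with (x * (csum u n - l))%C by ring.
  rewrite Cmod_mult.
  apply Rlt_div_r in HN; [|lra].
  pose proof (Cmod_ge_0 (csum u n - l)%C); nra.
Qed.

Lemma has_sum_finite (u : nat -> C) (n : nat) :
  (forall k, (n <= k)%nat -> u k = RtoC 0) -> has_sum u (csum u n).
Proof.
  intros H eps Heps; exists n; intros p Hp.
  replace p with (n + (p - n))%nat by lia.
  rewrite csum_add, (csum_zero (fun k => u (n + k)%nat)); [|intros; apply H; lia].
  replace (csum u n + 0 - csum u n)%C with (RtoC 0) by ring.
  now rewrite Cmod_0.
Qed.

Lemma has_sum_tail (u : nat -> C) (l : C) (n : nat) :
  has_sum u l -> has_sum (fun k => u (n + k)%nat) (l - csum u n)%C.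
Proof.
  intros H eps Heps; destruct (H eps Heps) as [N HN]; exists N; intros p Hp.
  specialize (HN (n + p)%nat ltac:(lia)); rewrite csum_add in HN.
  replace (csum (fun k => u (n + k)%nat) p - (l - csum u n))%C
    with (csum u n + csum (fun k => u (n + k)%nat) p - l)%C by ring.
  exact HN.
Qed.

Lemma Cmod_limit_le (u : nat -> C) (l : C) (M : R) :
  has_sum u l -> (forall n, Cmod (csum u n) <= M) -> Cmod l <= M.
Proof.
  intros H HM; apply le_epsilon; intros eps Heps.
  destruct (H eps Heps) as [N HN]; specialize (HN N (Nat.le_refl _)); specialize (HM N).
  pose proof (Cmod_triangle (csum u N) (- (csum u N - l))) as T.
  rewrite Cmod_opp in T.
  replace (csum u N + - (csum u N - l))%C with l in T by ring.
  lra.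
Qed.

Lemma Cmod_has_sum_le (u : nat -> C) (l : C) (M : R) :
  has_sum u l -> (forall n, rsum (fun k => Cmod (u k)) n <= M) -> Cmod l <= M.
Proof.
  intros H HM; apply (Cmod_limit_le u); [easy|].
  intros n; eapply Rle_trans; [apply Cmod_csum | apply HM].
Qed.

Lemma has_sum_of_abs (u : nat -> C) (M : R) :
  (forall n, rsum (fun k => Cmod (u k)) n <= M) -> exists l, has_sum u l.
Proof.
  intros HM.
  assert (He : ex_series (fun k => Cmod (u k))).
  { assert (Hl : ex_finite_lim_seq (sum_n (fun k => Cmod (u k)))).
    { apply ex_finite_lim_seq_incr with M.
      - intros n; rewrite !sum_n_rsum; simpl; pose proof (Cmod_ge_0 (u (S n))); lra.
      - intros n; rewrite sum_n_rsum; apply HM. }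
    destruct Hl as [l Hl]; exists l; exact Hl. }
  destruct (@ex_series_le C_AbsRing C_CompleteNormedModule u (fun k => Cmod (u k))) as [l Hl].
  - intros n; apply Rle_refl.
  - exact He.
  - exists l; apply is_series_has_sum; exact Hl.
Qed.

(** The Cauchy product of coefficient sequences. *)
Definition conv (u v : nat -> C) (n : nat) : C :=
  csum (fun i => u i * v (n - i)%nat)%C (S n).

Lemma csum_conv (u v : nat -> C) (N : nat) :
  csum (conv u v) N = csum (fun i => u i * csum v (N - i))%C N.
Proof.
  induction N as [|N IH]; [easy|].
  change (csum (conv u v) (S N)) with (csum (conv u v) N + conv u v N)%C.
  rewrite IH.
  rewrite (csum_ext (fun i => u i * csum v (S N - i))%C
             (fun i => u i * csum v (N - i) + u i * v (N - i)%nat)%C (S N)).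
  - rewrite csum_plus; unfold conv; f_equal; simpl.
    rewrite Nat.sub_diag; simpl; ring.
  - intros k Hk; replace (S N - k)%nat with (S (N - k)) by lia; simpl; ring.
Qed.

(** Mertens: with V_k the partial sums of v, the partial sum of the Cauchy product misses
    (sum of u) * V by the sum of u_i (V_{N-i} - V), in which either i is large, and then the
    tail of |u| is small, or N - i is large, and then V_{N-i} is close to V. *)
Lemma has_sum_conv (u v : nat -> C) (l l' : C) (M : R) :
  has_sum u l -> has_sum v l' -> (forall n, rsum (fun k => Cmod (u k)) n <= M) ->
  has_sum (conv u v) (l * l')%C.
Proof.
  intros Hu Hv HM eps Heps.
  assert (HM0 : 0 <= M) by exact (HM O).
  assert (HB : exists B, 0 <= B /\ forall n, Cmod (csum v n - l') <= B).
  { destruct (Hv 1 Rlt_0_1) as [K HK].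
    exists (rsum (fun n => Cmod (csum v n - l')) K + 1).
    assert (Hn : forall k, 0 <= Cmod (csum v k - l')) by (intros; apply Cmod_ge_0).
    assert (0 <= rsum (fun n => Cmod (csum v n - l')) K) by (apply rsum_nonneg; auto).
    split; [lra|]; intros n.
    destruct (Nat.le_gt_cases K n) as [Hk|Hk].
    - specialize (HK n Hk); lra.
    - pose proof (rsum_ge_term (fun n => Cmod (csum v n - l')) n Hn).
      pose proof (rsum_mono (fun n => Cmod (csum v n - l')) (S n) K Hn Hk).
      simpl in *; lra. }
  destruct HB as [B [HB0 HB]].
  set (e1 := eps / (M + B + Cmod l' + 1)).
  pose proof (Cmod_ge_0 l') as Hl'.
  assert (He1 : 0 < e1) by (apply Rdiv_lt_0_compat; lra).
  destruct (Hv e1 He1) as [K HK].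
  destruct (Hu e1 He1) as [K' HK'].
  destruct (rsum_tail (fun k => Cmod (u k)) M e1) as [n0 Hn0]; auto.
  { intros; apply Cmod_ge_0. }
  exists (n0 + K + K')%nat; intros N HN.
  rewrite csum_conv.
  replace (csum (fun i => u i * csum v (N - i)) N - l * l')%C
    with (csum (fun i => u i * (csum v (N - i) - l')) N + (csum u N - l) * l')%C.
  2:{ rewrite (csum_ext (fun i => u i * (csum v (N - i) - l'))%C
                 (fun i => u i * csum v (N - i) + (- l') * u i)%C) by (intros; ring).
      rewrite csum_plus, csum_scal; ring. }
  eapply Rle_lt_trans; [apply Cmod_triangle|].
  rewrite Cmod_mult.
  assert (H1 : Cmod (csum (fun i => u i * (csum v (N - i) - l')) N)%C <= M * e1 + B * e1).
  { eapply Rle_trans; [apply Cmod_csum|].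
    apply Rle_trans with
      (rsum (fun k => Cmod (u k * (csum v (N - k) - l'))%C) (n0 + (N - n0)));
      [right; f_equal; lia|].
    rewrite rsum_add; apply Rplus_le_compat.
    - apply Rle_trans with (rsum (fun k => e1 * Cmod (u k)) n0).
      + apply rsum_le; intros k Hk; rewrite Cmod_mult, Rmult_comm.
        apply Rmult_le_compat_r; [apply Cmod_ge_0|].
        left; apply HK; lia.
      + rewrite rsum_scal; pose proof (HM n0); nra.
    - apply Rle_trans with (rsum (fun k => B * Cmod (u (n0 + k)%nat)) (N - n0)).
      + apply rsum_le; intros k Hk; rewrite Cmod_mult, Rmult_comm.
        apply Rmult_le_compat_r; [apply Cmod_ge_0 | apply HB].
      + rewrite rsum_scal; apply Rmult_le_compat_l; auto. }
  specialize (HK' N ltac:(lia)).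
  assert (Cmod (csum u N - l) * Cmod l' <= e1 * Cmod l') by (apply Rmult_le_compat_r; lra).
  assert (e1 * (M + B + Cmod l' + 1) = eps) by (unfold e1; field; lra).
  nra.
Qed.

Definition sums_on (t : R) (u : nat -> C) (F : C -> C) : Prop :=
  forall z, Cmod z < t -> has_sum (fun k => u k * z ^ k)%C (F z).

(** Abel: the terms at a point of modulus s' between s and t are bounded, so those at modulus s are
    dominated by the geometric series of ratio s / s'. *)
Lemma sums_on_abs (t : R) (u : nat -> C) (F : C -> C) (s : R) :
  sums_on t u F -> 0 <= s < t ->
  exists M, 0 <= M /\ forall n, rsum (fun k => Cmod (u k) * s ^ k) n <= M.
Proof.
  intros H Hs; set (s' := (s + t) / 2).
  assert (Hs' : s < s' < t) by (unfold s'; lra).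
  assert (HB : exists B, 0 <= B /\ forall n, Cmod (u n) * s' ^ n <= B).
  { assert (Hz : Cmod (RtoC s') < t) by (rewrite Cmod_R, Rabs_pos_eq; lra).
    destruct (H _ Hz 1 Rlt_0_1) as [N HN].
    assert (Hp : forall k, 0 <= Cmod (u k) * s' ^ k)
      by (intros; apply Rmult_le_pos; [apply Cmod_ge_0 | apply pow_le; lra]).
    exists (rsum (fun k => Cmod (u k) * s' ^ k) N + 2).
    assert (0 <= rsum (fun k => Cmod (u k) * s' ^ k) N) by (apply rsum_nonneg; auto).
    split; [lra|]; intros n.
    destruct (Nat.le_gt_cases N n) as [Hn|Hn].
    - pose proof (HN n Hn) as A1; pose proof (HN (S n) ltac:(lia)) as A2; simpl csum in A2.
      set (S0 := csum _ n) in *.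
      pose proof (Cmod_triangle (S0 + u n * s' ^ n - F s') (- (S0 - F s'))) as T.
      rewrite Cmod_opp in T.
      replace (S0 + u n * s' ^ n - F s' + - (S0 - F s'))%C with (u n * s' ^ n)%C in T by ring.
      rewrite Cmod_mult, Cmod_pow, Cmod_R, Rabs_pos_eq in T; lra.
    - pose proof (rsum_ge_term _ n Hp); pose proof (rsum_mono _ (S n) N Hp Hn).
      simpl in *; lra. }
  destruct HB as [B [HB0 HB]].
  assert (Hq : 0 <= s / s' < 1).
  { split; [apply Rdiv_le_0_compat; lra|]. apply Rlt_div_l; lra. }
  exists (B * / (1 - s / s')).
  split; [apply Rmult_le_pos; [easy|left; apply Rinv_0_lt_compat; lra]|].
  intros n.
  apply Rle_trans with (B * rsum (fun k => (s / s') ^ k) n).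
  - rewrite <- rsum_scal; apply rsum_le; intros k _.
    specialize (HB k).
    replace (s ^ k) with (s' ^ k * (s / s') ^ k).
    2:{ rewrite <- Rpow_mult_distr; f_equal; field; lra. }
    rewrite <- Rmult_assoc; apply Rmult_le_compat_r; [apply pow_le; lra | exact HB].
  - apply Rmult_le_compat_l; [easy | now apply rsum_geom].
Qed.

Lemma sums_on_mult (t : R) (u v : nat -> C) (F G : C -> C) :
  sums_on t u F -> sums_on t v G -> sums_on t (conv u v) (fun z => F z * G z)%C.
Proof.
  intros Hu Hv z Hz.
  destruct (sums_on_abs t u F (Cmod z) Hu) as [M [_ HM]]; [split; [apply Cmod_ge_0|easy]|].
  apply has_sum_ext with (conv (fun k => u k * z ^ k)%C (fun k => v k * z ^ k)%C).
  - intros n; unfold conv.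
    rewrite Cmult_comm, <- csum_scal; apply csum_ext; intros k Hk.
    assert (E : (z ^ n = z ^ k * z ^ (n - k))%C) by (rewrite <- Cpow_add_r; f_equal; lia).
    rewrite E; ring.
  - apply has_sum_conv with M; [now apply Hu | now apply Hv |].
    intros n; eapply Rle_trans; [|apply (HM n)].
    apply rsum_le; intros k _; rewrite Cmod_mult, Cmod_pow; lra.
Qed.

(** * Means over roots of unity and Cauchy's estimate *)

Definition cis (x : R) : C := (cos x, sin x).

Lemma cis_add (x y : R) : cis (x + y) = (cis x * cis y)%C.
Proof. unfold cis, Cmult; simpl; rewrite cos_plus, sin_plus; f_equal; ring. Qed.

Lemma cis_0 : cis 0 = RtoC 1.
Proof. unfold cis; now rewrite cos_0, sin_0. Qed.

Lemma cis_2PI : cis (2 * PI) = RtoC 1.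
Proof. unfold cis; now rewrite cos_2PI, sin_2PI. Qed.

Lemma Cmod_cis (x : R) : Cmod (cis x) = 1.
Proof.
  transitivity (sqrt 1); [|apply sqrt_1]; unfold Cmod, cis; f_equal.
  pose proof (sin2_cos2 x); unfold Rsqr in *; simpl; lra.
Qed.

Lemma cis_pow (x : R) (n : nat) : (cis x ^ n)%C = cis (INR n * x).
Proof.
  induction n as [|n IH].
  - simpl INR; now rewrite Rmult_0_l, cis_0.
  - rewrite Cpow_S, IH, <- cis_add, S_INR; f_equal; ring.
Qed.

Lemma cis_neq_0 (x : R) : cis x <> RtoC 0.
Proof. intros E; apply (f_equal Cmod) in E; rewrite Cmod_cis, Cmod_0 in E; lra. Qed.

(** 1 - cos x = 2 sin^2 (x / 2), and the sine does not vanish strictly between 0 and PI. *)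
Lemma cis_neq_1 (x : R) : x <> 0 -> Rabs x < 2 * PI -> cis x <> RtoC 1.
Proof.
  intros Hx Hlt E; injection E; intros _ Hc.
  assert (Hs : sin (x / 2) = 0).
  { replace x with (2 * (x / 2)) in Hc by field.
    rewrite cos_2a_sin in Hc; nra. }
  assert (H : 0 < Rabs (x / 2) < PI).
  { unfold Rdiv; rewrite Rabs_mult, (Rabs_pos_eq (/ 2)) by lra.
    pose proof (Rabs_pos_lt x Hx); lra. }
  destruct (Rle_dec 0 (x / 2)) as [H0|H0].
  - rewrite Rabs_pos_eq in H by easy; pose proof (sin_gt_0 (x / 2)); lra.
  - rewrite Rabs_left in H by lra.
    pose proof (sin_gt_0 (- (x / 2))); rewrite sin_neg in *; lra.
Qed.

Lemma csum_geom (q : C) (N : nat) : ((1 - q) * csum (fun j => q ^ j) N)%C = (1 - q ^ N)%C.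
Proof.
  induction N as [|N IH]; simpl csum; [simpl; ring|].
  rewrite Cmult_plus_distr_l, IH, Cpow_S; ring.
Qed.

Lemma csum_const (x : C) (N : nat) : csum (fun _ => x) N = (RtoC (INR N) * x)%C.
Proof.
  induction N as [|N IH]; [simpl; ring|].
  rewrite S_INR, RtoC_plus; simpl csum; rewrite IH; ring.
Qed.

Lemma csum_single (u : nat -> C) (N n : nat) :
  (n < N)%nat -> (forall k, (k < N)%nat -> k <> n -> u k = RtoC 0) -> csum u N = u n.
Proof.
  induction N as [|N IH]; intros Hn H; [lia|].
  simpl; destruct (Nat.eq_dec n N) as [->|Hne].
  - rewrite csum_zero; [ring | intros; apply H; lia].
  - rewrite IH, (H N); [ring | lia | lia | lia | intros; apply H; lia].
Qed.

Definition circle_point (N : nat) (rho : R) (j : nat) : C :=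
  (RtoC rho * cis (INR j * (2 * PI / INR N)))%C.

(** The average over N equally spaced points replaces the integral over the circle of radius rho. *)
Definition circle_mean (N : nat) (rho : R) (G : C -> C) : C :=
  (RtoC (/ INR N) * csum (fun j => G (circle_point N rho j)) N)%C.

Lemma Cmod_circle_point (N j : nat) (rho : R) : 0 <= rho -> Cmod (circle_point N rho j) = rho.
Proof.
  intros H; unfold circle_point.
  rewrite Cmod_mult, Cmod_cis, Cmod_R, Rabs_pos_eq; lra.
Qed.

Lemma circle_mean_plus (N : nat) (rho : R) (F G : C -> C) :
  circle_mean N rho (fun z => F z + G z)%C = (circle_mean N rho F + circle_mean N rho G)%C.
Proof.
  unfold circle_mean.
  rewrite (csum_plus (fun j => F (circle_point N rho j)) (fun j => G (circle_point N rho j))).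
  ring.
Qed.

Lemma circle_mean_bound (N : nat) (rho M : R) (G : C -> C) :
  (0 < N)%nat -> 0 <= rho -> (forall z, Cmod z = rho -> Cmod (G z) <= M) ->
  Cmod (circle_mean N rho G) <= M.
Proof.
  intros HN Hr HM; apply lt_0_INR in HN; unfold circle_mean.
  assert (Hi : 0 < / INR N) by now apply Rinv_0_lt_compat.
  rewrite Cmod_mult, Cmod_R, Rabs_pos_eq by lra.
  apply Rle_trans with (/ INR N * (INR N * M)); [|right; field; lra].
  apply Rmult_le_compat_l; [lra|].
  eapply Rle_trans; [apply Cmod_csum|].
  rewrite <- rsum_const; apply rsum_le; intros k _.
  apply HM, Cmod_circle_point, Hr.
Qed.

(** The summands are the powers of q = e^(2 pi i (l - n) / N), which is not 1 although q^N = 1. *)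
Lemma roots_of_unity_orthogonal (N l n : nat) :
  (l < N)%nat -> (n < N)%nat -> l <> n ->
  csum (fun j => cis (INR j * (2 * PI / INR N)) ^ l / cis (INR j * (2 * PI / INR N)) ^ n)%C N
  = RtoC 0.
Proof.
  intros Hl Hn Hne.
  assert (HN : 0 < INR N) by (apply lt_0_INR; lia).
  pose proof PI_RGT_0 as Hpi.
  set (th := 2 * PI / INR N).
  set (q := cis ((INR l - INR n) * th)).
  rewrite (csum_ext _ (fun j => q ^ j)%C).
  2:{ intros j _; unfold q; rewrite !cis_pow.
      replace (INR j * ((INR l - INR n) * th))
        with (INR l * (INR j * th) + - (INR n * (INR j * th))) by ring.
      rewrite cis_add; unfold Cdiv; f_equal.
      assert (E : (cis (INR n * (INR j * th)) * cis (- (INR n * (INR j * th))))%C = RtoC 1).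
      { rewrite <- cis_add, Rplus_opp_r; apply cis_0. }
      set (X := cis (INR n * _)) in *; set (Y := cis (- _)) in *.
      assert (HX : X <> RtoC 0) by apply cis_neq_0.
      replace Y with ((X * Y) * / X)%C by (field; easy).
      rewrite E; ring. }
  assert (Hq : q <> RtoC 1).
  { apply cis_neq_1.
    - apply Rmult_integral_contrapositive; split.
      + apply Rminus_eq_contra; now apply not_INR.
      + unfold th; apply Rgt_not_eq, Rdiv_lt_0_compat; lra.
    - rewrite Rabs_mult, (Rabs_pos_eq th) by (unfold th; apply Rdiv_le_0_compat; lra).
      assert (Rabs (INR l - INR n) < INR N).
      { apply lt_INR in Hl, Hn; pose proof (pos_INR l); pose proof (pos_INR n).
        apply Rabs_def1; lra. }
      replace (2 * PI) with (INR N * th) by (unfold th; field; lra).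
      apply Rmult_lt_compat_r; [unfold th; apply Rdiv_lt_0_compat; lra | easy]. }
  assert (HqN : (q ^ N)%C = RtoC 1).
  { unfold q; rewrite cis_pow.
    replace (INR N * ((INR l - INR n) * th)) with (INR l * (2 * PI) + - (INR n * (2 * PI)))
      by (unfold th; field; lra).
    assert (H2 : forall k, cis (INR k * (2 * PI)) = RtoC 1)
      by (intros k; rewrite <- cis_pow, cis_2PI; apply Cpow_1_l).
    assert (E : (cis (INR n * (2 * PI)) * cis (- (INR n * (2 * PI))))%C = RtoC 1).
    { rewrite <- cis_add, Rplus_opp_r; apply cis_0. }
    rewrite H2 in E; rewrite cis_add, H2; exact E. }
  pose proof (csum_geom q N) as Hg; rewrite HqN in Hg.
  assert (Hq' : (1 - q)%C <> RtoC 0).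
  { intros E; apply Hq; replace q with (1 - (1 - q))%C by ring; rewrite E; ring. }
  set (S0 := csum _ N) in *.
  replace S0 with (/ (1 - q) * ((1 - q) * S0))%C by (field; easy).
  rewrite Hg; ring.
Qed.

Lemma circle_mean_poly (N n : nat) (rho : R) (u : nat -> C) :
  (n < N)%nat -> 0 < rho ->
  circle_mean N rho (fun z => csum (fun k => u k * z ^ k)%C N / z ^ n)%C = u n.
Proof.
  intros Hn Hr.
  assert (HN : 0 < INR N) by (apply lt_0_INR; lia).
  assert (Hrc : RtoC rho <> RtoC 0) by (intros E; injection E; lra).
  unfold circle_mean.
  set (x := fun j => cis (INR j * (2 * PI / INR N))).
  rewrite (csum_ext _ (fun j => csum (fun k => u k * (rho ^ k / rho ^ n) * (x j ^ k / x j ^ n))%C N)).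
  2:{ intros j _; unfold circle_point, Cdiv; rewrite Cmult_comm, <- csum_scal.
      apply csum_ext; intros k _.
      rewrite !Cpow_mult_l; fold (x j); field.
      split; apply Cpow_nz; [apply cis_neq_0 | easy]. }
  rewrite csum_swap.
  rewrite (csum_ext _ (fun k => (u k * (rho ^ k / rho ^ n)) * csum (fun j => x j ^ k / x j ^ n) N)%C)
    by (intros; apply csum_scal).
  rewrite (csum_single _ N n Hn).
  - rewrite (csum_ext _ (fun _ => RtoC 1)).
    2:{ intros; field; apply Cpow_nz, cis_neq_0. }
    rewrite csum_const, RtoC_inv by lra; field.
    split; [apply Cpow_nz; easy | intros E; injection E; lra].
  - intros k Hk Hkn; unfold x.
    rewrite (roots_of_unity_orthogonal N k n) by easy; ring.
Qed.

(** By orthogonality the terms of degree less than N contribute u n exactly; the others are bounded by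
    the tail of the majorant series at radius rho. *)
Lemma circle_mean_coeff (t rho : R) (u : nat -> C) (F : C -> C) (n : nat) (eps : R) :
  sums_on t u F -> 0 < rho < t -> 0 < eps ->
  exists N0, forall N, (N0 <= N)%nat ->
    Cmod (circle_mean N rho (fun z => F z / z ^ n) - u n)%C <= eps.
Proof.
  intros HF Hr Heps.
  destruct (sums_on_abs t u F rho HF) as [M [_ HM]]; [lra|].
  assert (Hrn : 0 < rho ^ n) by (apply pow_lt; lra).
  assert (Hpos : forall k, 0 <= Cmod (u k) * rho ^ k)
    by (intros; apply Rmult_le_pos; [apply Cmod_ge_0 | apply pow_le; lra]).
  destruct (rsum_tail _ M (eps * rho ^ n) Hpos HM) as [N0 HN0]; [nra|].
  exists (S (N0 + n)); intros N HN.
  set (P := fun z => csum (fun k => u k * z ^ k)%C N).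
  replace (circle_mean N rho (fun z => F z / z ^ n)%C)
    with (circle_mean N rho (fun z => P z / z ^ n)%C
          + circle_mean N rho (fun z => (F z - P z) / z ^ n)%C)%C.
  2:{ rewrite <- circle_mean_plus; unfold circle_mean; f_equal; apply csum_ext; intros j _.
      unfold Cdiv; ring. }
  unfold P at 1; rewrite circle_mean_poly by (lia || lra).
  set (m2 := circle_mean _ _ _); replace (u n + m2 - u n)%C with m2 by ring; unfold m2.
  apply circle_mean_bound; [lia | lra |].
  intros z Hz.
  assert (Hz0 : z <> RtoC 0) by (apply Cmod_gt_0; lra).
  rewrite Cmod_div, Cmod_pow, Hz by (now apply Cpow_nz).
  apply Rle_div_l; [easy|].
  apply (Cmod_has_sum_le (fun k => u (N + k)%nat * z ^ (N + k))%C).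
  - apply (has_sum_tail (fun k => u k * z ^ k)%C), HF; lra.
  - intros p.
    apply Rle_trans with (rsum (fun k => Cmod (u (N0 + k)%nat) * rho ^ (N0 + k)) ((N - N0) + p)).
    + rewrite rsum_add.
      assert (0 <= rsum (fun k => Cmod (u (N0 + k)%nat) * rho ^ (N0 + k)) (N - N0))
        by (apply rsum_nonneg; auto).
      enough (rsum (fun k => Cmod (u (N + k)%nat * z ^ (N + k))%C) p
              <= rsum (fun k => Cmod (u (N0 + (N - N0 + k))%nat) * rho ^ (N0 + (N - N0 + k))) p) by lra.
      apply rsum_le; intros k _.
      replace (N0 + (N - N0 + k))%nat with (N + k)%nat by lia.
      rewrite Cmod_mult, Cmod_pow, Hz; lra.
    + apply HN0.
Qed.

(** The coefficient is the limit of averages of F z / z^n, each bounded by M / rho^n. *)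
Lemma cauchy_estimate (t rho M : R) (u : nat -> C) (F : C -> C) (n : nat) :
  sums_on t u F -> 0 < rho < t -> (forall z, Cmod z = rho -> Cmod (F z) <= M) ->
  Cmod (u n) * rho ^ n <= M.
Proof.
  intros HF Hr HM.
  assert (Hrn : 0 < rho ^ n) by (apply pow_lt; lra).
  apply Rle_div_r; [easy|].
  apply le_epsilon; intros eps Heps.
  destruct (circle_mean_coeff t rho u F n eps HF Hr Heps) as [N0 HN0].
  specialize (HN0 (S N0) ltac:(lia)).
  assert (HB : Cmod (circle_mean (S N0) rho (fun z => F z / z ^ n)%C) <= M / rho ^ n).
  { apply circle_mean_bound; [lia | lra |]; intros z Hz.
    rewrite Cmod_div, Cmod_pow, Hz by (apply Cpow_nz, Cmod_gt_0; lra).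
    apply Rmult_le_compat_r; [left; now apply Rinv_0_lt_compat | now apply HM]. }
  set (m := circle_mean _ _ _) in *.
  pose proof (Cmod_triangle m (- (m - u n))) as T; rewrite Cmod_opp in T.
  replace (m + - (m - u n))%C with (u n) in T by ring; lra.
Qed.

(** * Second-order regularity of analytic functions *)

Definition quad_approx (F : C -> C) (K : R) (L z w : C) : Prop :=
  Cmod (F w - F z - L * (w - z)) <= K * Cmod (w - z) ^ 2.

(** Continuous complex differentiability near z0 in a quantitative form: the bounds are uniform near z0,
    so that they pass to compact sets, and they are stable under products and inverses. *)
Definition regular_at (F : C -> C) (z0 : C) : Prop :=
  exists delta K, 0 < delta /\ 0 <= K /\
    forall z, Cmod (z - z0) < delta ->
      Cmod (F z) <= K /\
      exists L, Cmod L <= K /\ forall w, Cmod (w - z0) < delta -> quad_approx F K L z w.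

Lemma Cmod_triangle3 (x y z : C) : Cmod (x + y + z) <= Cmod x + Cmod y + Cmod z.
Proof. pose proof (Cmod_triangle (x + y) z); pose proof (Cmod_triangle x y); lra. Qed.

Lemma Cmod_minus_sym (x y : C) : Cmod (x - y) = Cmod (y - x).
Proof. rewrite <- Cmod_opp; f_equal; ring. Qed.

Lemma regular_at_mult (F G : C -> C) (z0 : C) :
  regular_at F z0 -> regular_at G z0 -> regular_at (fun z => F z * G z)%C z0.
Proof.
  intros [d1 [K1 [Hd1 [HK1 HF]]]] [d2 [K2 [Hd2 [HK2 HG]]]].
  exists (Rmin (1 / 2) (Rmin d1 d2)), (4 * (K1 * K2)).
  assert (HK : 0 <= K1 * K2) by now apply Rmult_le_pos.
  split; [repeat apply Rmin_pos; lra|]; split; [lra|].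
  intros z Hz.
  pose proof (Rmin_l (1 / 2) (Rmin d1 d2)); pose proof (Rmin_r (1 / 2) (Rmin d1 d2)).
  pose proof (Rmin_l d1 d2); pose proof (Rmin_r d1 d2).
  destruct (HF z) as [BF [L1 [HL1 E1]]]; [lra|].
  destruct (HG z) as [BG [L2 [HL2 E2]]]; [lra|].
  assert (Hprod : forall x y, Cmod x <= K1 -> Cmod y <= K2 -> Cmod (x * y) <= K1 * K2).
  { intros x y Hx Hy; rewrite Cmod_mult; apply Rmult_le_compat; auto; apply Cmod_ge_0. }
  split; [specialize (Hprod _ _ BF BG); lra|].
  exists (L1 * G z + F z * L2)%C; split.
  { eapply Rle_trans; [apply Cmod_triangle|].
    pose proof (Hprod _ _ HL1 BG); pose proof (Hprod _ _ BF HL2); lra. }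
  intros w Hw.
  assert (Hd : Cmod (w - z) <= 1).
  { pose proof (Cmod_triangle (w - z0) (z0 - z)) as T.
    replace (w - z0 + (z0 - z))%C with (w - z)%C in T by ring.
    rewrite (Cmod_minus_sym z0 z) in T; lra. }
  specialize (E1 w ltac:(lra)); specialize (E2 w ltac:(lra)).
  destruct (HG w) as [BG' _]; [lra|].
  unfold quad_approx in *.
  pose proof (Cmod_ge_0 (w - z)) as Hh0.
  set (h := (w - z)%C) in *.
  assert (DG : Cmod (G w - G z) <= 2 * K2 * Cmod h).
  { replace (G w - G z)%C with ((G w - G z - L2 * h) + L2 * h)%C by ring.
    eapply Rle_trans; [apply Cmod_triangle|]; rewrite Cmod_mult.
    pose proof (Cmod_ge_0 L2).
    assert (Cmod L2 * Cmod h <= K2 * Cmod h) by (apply Rmult_le_compat_r; lra).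
    assert (K2 * Cmod h ^ 2 <= K2 * Cmod h) by (apply Rmult_le_compat_l; nra).
    lra. }
  replace (F w * G w - F z * G z - (L1 * G z + F z * L2) * h)%C
    with ((F w - F z - L1 * h) * G w + F z * (G w - G z - L2 * h)
          + (L1 * h) * (G w - G z))%C by ring.
  eapply Rle_trans; [apply Cmod_triangle3|]; rewrite !Cmod_mult.
  assert (A1 : Cmod (F w - F z - L1 * h) * Cmod (G w) <= (K1 * Cmod h ^ 2) * K2)
    by (apply Rmult_le_compat; auto; apply Cmod_ge_0).
  assert (A2 : Cmod (F z) * Cmod (G w - G z - L2 * h) <= K1 * (K2 * Cmod h ^ 2))
    by (apply Rmult_le_compat; auto; apply Cmod_ge_0).
  assert (A3 : Cmod L1 * Cmod h * Cmod (G w - G z) <= (K1 * Cmod h) * (2 * K2 * Cmod h)).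
  { apply Rmult_le_compat; auto; try apply Cmod_ge_0.
    - apply Rmult_le_pos; apply Cmod_ge_0.
    - apply Rmult_le_compat_r; auto. }
  lra.
Qed.

Lemma regular_at_const (x z0 : C) : regular_at (fun _ => x) z0.
Proof.
  exists 1, (Cmod x); split; [lra|]; split; [apply Cmod_ge_0|].
  intros z _; split; [lra|]; exists (RtoC 0); split.
  - rewrite Cmod_0; apply Cmod_ge_0.
  - intros w _; unfold quad_approx; replace (x - x - 0 * (w - z))%C with (RtoC 0) by ring; rewrite Cmod_0.
    apply Rmult_le_pos; [apply Cmod_ge_0 | apply pow_le, Cmod_ge_0].
Qed.

Lemma regular_at_pow (F : C -> C) (z0 : C) (n : nat) :
  regular_at F z0 -> regular_at (fun z => F z ^ n)%C z0.
Proof.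
  intros H; induction n as [|n IH]; simpl.
  - apply regular_at_const.
  - now apply regular_at_mult.
Qed.

Lemma regular_at_inv (z0 : C) : z0 <> RtoC 0 -> regular_at Cinv z0.
Proof.
  intros H0; apply Cmod_gt_0 in H0.
  set (m := Cmod z0 / 2).
  assert (Hm : 0 < m) by (unfold m; lra).
  assert (Hb : forall z, Cmod (z - z0) < m -> z <> RtoC 0 /\ / Cmod z <= / m).
  { intros z Hz.
    pose proof (Cmod_triangle z (z0 - z)) as T.
    replace (z + (z0 - z))%C with z0 in T by ring.
    rewrite Cmod_minus_sym in T.
    assert (m <= Cmod z) by (unfold m in *; lra).
    split; [apply Cmod_gt_0; lra | apply Rinv_le_contravar; lra]. }
  assert (Hi : 0 < / m) by now apply Rinv_0_lt_compat.
  exists m, (/ m + / m ^ 2 + / m ^ 3); split; [easy|].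
  rewrite <- !pow_inv.
  pose proof (pow_lt (/ m) 2 Hi); pose proof (pow_lt (/ m) 3 Hi).
  split; [lra|].
  intros z Hz; destruct (Hb z Hz) as [Hz0 Iz].
  assert (0 < / Cmod z) by (apply Rinv_0_lt_compat, Cmod_gt_0; easy).
  assert (Sq : (/ Cmod z) ^ 2 <= (/ m) ^ 2) by (apply pow_incr; lra).
  split; [rewrite Cmod_inv by easy; lra|].
  exists (- (/ z) ^ 2)%C; split.
  - rewrite Cmod_opp, Cmod_pow, Cmod_inv by easy; lra.
  - intros w Hw; destruct (Hb w Hw) as [Hw0 Iw].
    assert (0 < / Cmod w) by (apply Rinv_0_lt_compat, Cmod_gt_0; easy).
    unfold quad_approx.
    replace (/ w - / z - - (/ z) ^ 2 * (w - z))%C with (/ w * (/ z) ^ 2 * (w - z) ^ 2)%C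
      by (field; easy).
    rewrite !Cmod_mult, !Cmod_pow, !Cmod_inv by easy.
    apply Rmult_le_compat_r; [apply pow_le, Cmod_ge_0|].
    apply Rle_trans with (/ m * (/ m) ^ 2); [|simpl; lra].
    apply Rmult_le_compat; try lra; apply pow_le; lra.
Qed.

(** The derivative of z^k at y, as the recursion given by the product rule. *)
Fixpoint dpow (y : C) (k : nat) : C :=
  match k with O => RtoC 0 | S k' => (y ^ k' + y * dpow y k')%C end.

Lemma dpow_bound (y : C) (s : R) (k : nat) :
  Cmod y <= s -> s * Cmod (dpow y k) <= (2 * s) ^ k.
Proof.
  intros Hy; pose proof (Cmod_ge_0 y).
  enough (s * Cmod (dpow y k) <= INR k * s ^ k).
  { eapply Rle_trans; [eassumption|]; rewrite Rpow_mult_distr.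
    apply Rmult_le_compat_r; [apply pow_le; lra|].
    clear; induction k as [|k IH]; [simpl; lra|].
    rewrite S_INR; simpl; pose proof (pow_R1_Rle 2 k); lra. }
  induction k as [|k IH]; [simpl; rewrite Cmod_0; lra|].
  simpl dpow; rewrite S_INR; simpl.
  pose proof (Cmod_triangle (y ^ k) (y * dpow y k)) as T.
  rewrite Cmod_mult, Cmod_pow in T.
  assert (Cmod y ^ k <= s ^ k) by (apply pow_incr; lra).
  pose proof (Cmod_ge_0 (dpow y k)).
  apply Rle_trans with (s * (Cmod y ^ k + Cmod y * Cmod (dpow y k)));
    [apply Rmult_le_compat_l; lra|].
  assert (Cmod y * (s * Cmod (dpow y k)) <= s * (INR k * s ^ k)).
  { apply Rmult_le_compat; try lra; apply Rmult_le_pos; lra. }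
  assert (s * Cmod y ^ k <= s * s ^ k) by (apply Rmult_le_compat_l; lra).
  lra.
Qed.

(** Induction on x^(k+1) - y^(k+1) = x (x^k - y^k) + y^k (x - y): the error at k + 1 is x times the error at
    k plus dpow y k (x - y)^2. The factor 4^k absorbs the quadratic growth in k of the constants. *)
Lemma pow_quad (x y : C) (s : R) (k : nat) :
  Cmod x <= s -> Cmod y <= s ->
  s ^ 2 * Cmod (x ^ k - y ^ k - dpow y k * (x - y)) <= (4 * s) ^ k * Cmod (x - y) ^ 2.
Proof.
  intros Hx Hy; pose proof (Cmod_ge_0 x) as Hx0.
  assert (Hs : 0 <= s) by lra.
  pose proof (pow_le _ 2 (Cmod_ge_0 (x - y))) as Hd.
  induction k as [|k IH].
  - simpl Cpow; simpl dpow.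
    replace (1 - 1 - 0 * (x - y))%C with (RtoC 0) by ring; rewrite Cmod_0; simpl in *; lra.
  - simpl dpow; rewrite !Cpow_S.
    replace (x * x ^ k - y * y ^ k - (y ^ k + y * dpow y k) * (x - y))%C
      with (x * (x ^ k - y ^ k - dpow y k * (x - y)) + dpow y k * (x - y) ^ 2)%C by (simpl; ring).
    set (E := (x ^ k - y ^ k - dpow y k * (x - y))%C) in *.
    pose proof (Cmod_triangle (x * E) (dpow y k * (x - y) ^ 2)) as T.
    rewrite !Cmod_mult, Cmod_pow in T.
    pose proof (dpow_bound y s k Hy) as B.
    pose proof (Cmod_ge_0 E); pose proof (Cmod_ge_0 (dpow y k)).
    set (D := Cmod (x - y) ^ 2) in *.
    apply Rle_trans with (s ^ 2 * (Cmod x * Cmod E + Cmod (dpow y k) * D));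
      [apply Rmult_le_compat_l; [apply pow_le; lra | lra]|].
    assert (A1 : Cmod x * (s ^ 2 * Cmod E) <= s * ((4 * s) ^ k * D)).
    { apply Rmult_le_compat; try lra.
      apply Rmult_le_pos; [apply pow_le; lra | lra]. }
    assert (A2 : s * D * (s * Cmod (dpow y k)) <= s * D * (2 * s) ^ k).
    { apply Rmult_le_compat_l; [apply Rmult_le_pos; lra | lra]. }
    assert (A3 : s * D * (2 * s) ^ k <= s * D * (4 * s) ^ k).
    { apply Rmult_le_compat_l; [apply Rmult_le_pos; lra | apply pow_incr; lra]. }
    assert (0 <= s * D * (4 * s) ^ k).
    { apply Rmult_le_pos; [apply Rmult_le_pos; lra | apply pow_le; lra]. }
    simpl pow in *; lra.
Qed.

Lemma analytic_at_sums_on (F : C -> C) (z0 : C) :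
  analytic_at F z0 -> exists t u, 0 < t /\ sums_on t u (fun h => F (z0 + h)%C).
Proof.
  intros [u [t [Ht H]]]; exists t, u; split; [easy|]; intros h Hh.
  assert (E : (Cminus (z0 + h) z0)%C = h) by ring.
  specialize (H (z0 + h)%C); rewrite E in H.
  apply is_pseries_has_sum; auto.
Qed.

(** Summing the second-order errors of the monomials: the radius s = t / 8 leaves room for the factor
    4^k of [pow_quad]. *)
Lemma analytic_regular_at (F : C -> C) (z0 : C) : analytic_at F z0 -> regular_at F z0.
Proof.
  intros H; destruct (analytic_at_sums_on F z0 H) as [t [u [Ht Hu]]].
  set (s := t / 8); assert (Hs : 0 < s) by (unfold s; lra).
  destruct (sums_on_abs t u _ (4 * s) Hu) as [M [HM0 HM]]; [unfold s; lra|].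
  assert (Hs2 : 0 < s ^ 2) by (apply pow_lt; lra).
  assert (Hi : 0 < / s) by (apply Rinv_0_lt_compat; lra).
  assert (Hi2 : 0 < / s ^ 2) by (apply Rinv_0_lt_compat; lra).
  exists s, (M + M / s + M / s ^ 2); split; [easy|].
  assert (0 <= M / s) by (apply Rmult_le_pos; lra).
  assert (0 <= M / s ^ 2) by (apply Rmult_le_pos; lra).
  split; [lra|].
  (* every estimate below compares a series with the majorant of u at radius 4 * s *)
  assert (Cmp : forall (v : nat -> C) (c : R), 0 <= c ->
    (forall k, Cmod (v k) <= c * (Cmod (u k) * (4 * s) ^ k)) ->
    forall n, rsum (fun k => Cmod (v k)) n <= c * M).
  { intros v c Hc Hv n; eapply Rle_trans; [apply rsum_le; intros k _; apply Hv|].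
    rewrite rsum_scal; apply Rmult_le_compat_l; auto. }
  intros z Hz.
  set (y := (z - z0)%C) in *.
  assert (Hser : forall w, Cmod (w - z0) < s -> has_sum (fun k => u k * (w - z0) ^ k)%C (F w)).
  { intros w Hw; replace (F w) with (F (z0 + (w - z0))%C) by (f_equal; ring).
    apply Hu; unfold s in *; lra. }
  pose proof (Hser z Hz) as Hy; fold y in Hy.
  split.
  - apply Rle_trans with (1 * M); [|lra].
    apply (Cmod_has_sum_le _ _ _ Hy), Cmp; [lra|]; intros k.
    rewrite Cmod_mult, Cmod_pow, Rmult_1_l.
    apply Rmult_le_compat_l; [apply Cmod_ge_0|].
    apply pow_incr; split; [apply Cmod_ge_0 | lra].
  - assert (HLb : forall n, rsum (fun k => Cmod (u k * dpow y k)%C) n <= / s * M).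
    { apply Cmp; [lra|]; intros k; rewrite Cmod_mult.
      pose proof (dpow_bound y s k ltac:(lra)) as B.
      assert ((2 * s) ^ k <= (4 * s) ^ k) by (apply pow_incr; lra).
      replace (/ s * (Cmod (u k) * (4 * s) ^ k)) with (Cmod (u k) * ((4 * s) ^ k / s)) by (field; lra).
      apply Rmult_le_compat_l; [apply Cmod_ge_0|].
      apply Rle_div_r; lra. }
    destruct (has_sum_of_abs _ _ HLb) as [L HL].
    exists L; split.
    + pose proof (Cmod_has_sum_le _ _ _ HL HLb); unfold Rdiv in *; lra.
    + intros w Hw; pose proof (Hser w Hw) as Hx.
      set (x := (w - z0)%C) in *; unfold quad_approx.
      replace (w - z)%C with (x - y)%C by (unfold x, y; ring).
      apply Rle_trans with ((/ s ^ 2 * Cmod (x - y) ^ 2) * M).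
      * apply (Cmod_has_sum_le (fun k => u k * (x ^ k - y ^ k - dpow y k * (x - y)))%C).
        -- pose proof (has_sum_plus _ _ _ _
             (has_sum_plus _ _ _ _ Hx (has_sum_scal (- (1))%C _ _ Hy))
             (has_sum_scal (- (x - y))%C _ _ HL)) as HS.
           replace (F w - F z - L * (x - y))%C with (F w + - (1) * F z + - (x - y) * L)%C by ring.
           revert HS; apply has_sum_ext; intros k; ring.
        -- apply Cmp.
           ++ apply Rmult_le_pos; [lra | apply pow_le, Cmod_ge_0].
           ++ intros k; rewrite Cmod_mult.
              pose proof (pow_quad x y s k ltac:(lra) ltac:(lra)) as B.
              replace (/ s ^ 2 * Cmod (x - y) ^ 2 * (Cmod (u k) * (4 * s) ^ k))
                with (Cmod (u k) * ((4 * s) ^ k * Cmod (x - y) ^ 2 / s ^ 2)) by (field; lra).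
              apply Rmult_le_compat_l; [apply Cmod_ge_0|].
              apply Rle_div_r; lra.
      * pose proof (pow_le _ 2 (Cmod_ge_0 (x - y))).
        replace (/ s ^ 2 * Cmod (x - y) ^ 2 * M) with (M / s ^ 2 * Cmod (x - y) ^ 2)
          by (field; lra).
        apply Rmult_le_compat_r; lra.
Qed.

Lemma Cmod_le_Re_Im (z : C) : Cmod z <= Rabs (fst z) + Rabs (snd z).
Proof.
  destruct z as [x y]; simpl.
  replace ((x, y) : C) with (RtoC x + Ci * RtoC y)%C
    by (unfold Ci, Cplus, Cmult, RtoC; simpl; f_equal; ring).
  eapply Rle_trans; [apply Cmod_triangle|].
  rewrite Cmod_mult, Cmod_Ci, !Cmod_R; lra.
Qed.

Definition quad_approx_on_ball (G : C -> C) (K d : R) (z : C) : Prop :=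
  exists L, Cmod L <= K /\ forall w, Cmod (w - z) < d -> quad_approx G K L z w.

Lemma quad_approx_on_ball_weaken (G : C -> C) (K K' d d' : R) (z : C) :
  K <= K' -> d' <= d -> quad_approx_on_ball G K d z -> quad_approx_on_ball G K' d' z.
Proof.
  intros HK Hd [L [HL HE]]; exists L; split; [lra|]; intros w Hw.
  eapply Rle_trans; [apply HE; lra|].
  apply Rmult_le_compat_r; [apply pow_le, Cmod_ge_0 | easy].
Qed.

(** Compactness of the closed annulus. The gauge delta serves both as radius and, inverted, as constant,
    so a lower bound d for delta gives the uniform radius d and the uniform constant 1 / d. *)
Lemma uniform_quad_approx (G : C -> C) (r1 r2 : R) :
  r2 <= 1 ->
  (forall z, r1 <= Cmod z <= r2 -> regular_at G z) ->
  exists d K, 0 < d /\ 0 <= K /\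
    forall z, r1 <= Cmod z <= r2 -> quad_approx_on_ball G K d z.
Proof.
  intros Hr2 HG.
  assert (Hloc : forall x y : R, exists d : posreal, forall z,
    r1 <= Cmod z <= r2 -> Cmod (z - (x, y)) < 2 * d -> quad_approx_on_ball G (/ d) d z).
  { intros x y; set (z0 := (x, y) : C).
    destruct (classic (r1 <= Cmod z0 <= r2)) as [Hin|Hout].
    - destruct (HG z0 Hin) as [d0 [K [Hd0 [HK H]]]].
      assert (HdK : 0 < / (K + 1)) by (apply Rinv_0_lt_compat; lra).
      assert (Hd : 0 < Rmin (d0 / 4) (/ (K + 1))) by (apply Rmin_pos; lra).
      exists (mkposreal _ Hd); simpl; intros z _ Hz.
      pose proof (Rmin_l (d0 / 4) (/ (K + 1))); pose proof (Rmin_r (d0 / 4) (/ (K + 1))).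
      set (d := Rmin _ _) in *.
      apply quad_approx_on_ball_weaken with K d; [|lra|].
      + assert (/ / (K + 1) <= / d) by (apply Rinv_le_contravar; lra).
        rewrite Rinv_inv in *; lra.
      + destruct (H z) as [_ [L [HL HE]]]; [lra|].
        exists L; split; [easy|]; intros w Hw; apply HE.
        pose proof (Cmod_triangle (w - z) (z - z0)) as T.
        replace (w - z + (z - z0))%C with (w - z0)%C in T by ring; lra.
    (* off the annulus the gauge is so small that its ball misses the annulus *)
    - assert (Hg : exists g, 0 < g /\ forall z, r1 <= Cmod z <= r2 -> 2 * g <= Cmod (z - z0)).
      { assert (Hd : Cmod z0 < r1 \/ r2 < Cmod z0) by lra.
        destruct Hd as [Hd|Hd].
        - exists ((r1 - Cmod z0) / 2); split; [lra|]; intros z Hz.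
          pose proof (Cmod_triangle (z - z0) z0) as T.
          replace (z - z0 + z0)%C with z in T by ring; lra.
        - exists ((Cmod z0 - r2) / 2); split; [lra|]; intros z Hz.
          pose proof (Cmod_triangle (z0 - z) z) as T.
          replace (z0 - z + z)%C with z0 in T by ring; rewrite Cmod_minus_sym in T; lra. }
      destruct Hg as [g [Hg0 Hg]]; exists (mkposreal g Hg0); simpl.
      intros z Hz Hz'; specialize (Hg z Hz); lra. }
  set (delta := fun x y => proj1_sig (constructive_indefinite_description _ (Hloc x y))).
  assert (Hdelta : forall x y z, r1 <= Cmod z <= r2 -> Cmod (z - (x, y)) < 2 * delta x y ->
            quad_approx_on_ball G (/ delta x y) (delta x y) z).
  { intros x y; unfold delta; apply proj2_sig. }
  destruct (compactness_value_2d (-1) 1 (-1) 1 delta) as [d Hd].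
  exists d, (/ d); split; [apply cond_pos|].
  split; [left; apply Rinv_0_lt_compat, cond_pos|].
  intros z Hz; destruct z as [x y].
  pose proof (Rmax_Cmod (x, y)) as Hm; simpl in Hm.
  pose proof (Rmax_l (Rabs x) (Rabs y)); pose proof (Rmax_r (Rabs x) (Rabs y)).
  assert (Hx : -1 <= x <= 1) by (apply Rabs_le_between; lra).
  assert (Hy : -1 <= y <= 1) by (apply Rabs_le_between; lra).
  specialize (Hd x y Hx Hy); apply NNPP in Hd.
  destruct Hd as [a [b [_ [_ [Ha [Hb Hab]]]]]].
  apply quad_approx_on_ball_weaken with (/ delta a b) (delta a b); [|easy|].
  - apply Rinv_le_contravar; [apply cond_pos | easy].
  - apply Hdelta; [easy|].
    eapply Rle_lt_trans; [apply Cmod_le_Re_Im|]; simpl.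
    unfold Rminus in *; lra.
Qed.

(** * Independence of circle means of the radius *)

Lemma exp_quad (x : R) : 0 <= x <= 1 / 2 -> 0 <= exp x - 1 - x <= 2 * x ^ 2.
Proof.
  intros Hx; pose proof (exp_ineq1_le x); split; [lra|].
  pose proof (exp_ineq1_le (- x)) as H1; rewrite exp_Ropp in H1.
  assert (H2 : exp x <= / (1 - x)).
  { rewrite <- (Rinv_inv (exp x)); apply Rinv_le_contravar; lra. }
  assert (H3 : / (1 - x) <= 1 + x + 2 * x ^ 2).
  { apply Rmult_le_reg_l with (1 - x); [lra|]; rewrite Rinv_r by lra; simpl; nra. }
  lra.
Qed.

Lemma one_minus_cos_bound (x : R) : 0 <= x -> 0 <= 1 - cos x <= x ^ 2 / 2.
Proof.
  intros Hx; replace x with (2 * (x / 2)) at 1 2 by field.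
  rewrite cos_2a_sin.
  assert (H : Rabs (sin (x / 2)) <= x / 2).
  { destruct (Req_dec x 0) as [->|Hne].
    - replace (0 / 2) with 0 by field; rewrite sin_0, Rabs_R0; lra.
    - pose proof (sin_lt_x (x / 2)); pose proof (sin_gt_x (- (x / 2))).
      pose proof (sin_lt_x (x / 2)).
      destruct (Rle_dec 0 (sin (x / 2))); [rewrite Rabs_pos_eq; lra|].
      assert (x / 2 > PI) as Hp.
      { apply Rnot_le_lt; intros Hp; apply n, sin_ge_0; lra. }
      pose proof (SIN_bound (x / 2)); pose proof PI2_1.
      rewrite Rabs_left; lra. }
  pose proof (pow2_abs (sin (x / 2))) as E.
  assert (Rabs (sin (x / 2)) ^ 2 <= (x / 2) ^ 2)
    by (apply pow_incr; split; [apply Rabs_pos | easy]).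
  pose proof (pow2_ge_0 (sin (x / 2))).
  simpl in *; nra.
Qed.

Lemma sin_quad (x : R) : 0 <= x <= 1 -> Rabs (sin x - x) <= x ^ 2 / 2.
Proof.
  intros Hx; destruct (Req_dec x 0) as [->|Hne].
  { rewrite sin_0, Rminus_0_r, Rabs_R0; simpl; lra. }
  destruct (MVT_cor2 (fun t => sin t - t) (fun t => cos t - 1) 0 x) as [c [E Hc]]; [lra| |].
  { intros c _; apply derivable_pt_lim_minus; [apply derivable_pt_lim_sin | apply derivable_pt_lim_id]. }
  rewrite sin_0 in E; replace (sin x - x) with ((cos c - 1) * x) by lra.
  pose proof (one_minus_cos_bound c ltac:(lra)) as B.
  rewrite Rabs_mult, (Rabs_pos_eq x), Rabs_minus_sym, Rabs_pos_eq by lra.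
  assert (c ^ 2 <= x ^ 2) by (apply pow_incr; lra).
  pose proof (pow2_ge_0 x); simpl in *; nra.
Qed.

Lemma cis_quad (x : R) : 0 <= x <= 1 -> Cmod (cis x - 1 - Ci * x) <= x ^ 2.
Proof.
  intros Hx; eapply Rle_trans; [apply Cmod_le_Re_Im|].
  replace (fst (cis x - 1 - Ci * x)%C) with (- (1 - cos x)) by (simpl; ring).
  replace (snd (cis x - 1 - Ci * x)%C) with (sin x - x) by (simpl; ring).
  pose proof (one_minus_cos_bound x ltac:(lra)); pose proof (sin_quad x Hx).
  rewrite Rabs_Ropp, Rabs_pos_eq; lra.
Qed.

Lemma cis_minus_1_bound (x : R) : 0 <= x <= 1 -> Cmod (cis x - 1) <= 2 * x.
Proof.
  intros Hx; pose proof (cis_quad x Hx).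
  pose proof (Cmod_triangle (cis x - 1 - Ci * x) (Ci * x)) as T.
  replace (cis x - 1 - Ci * x + Ci * x)%C with (cis x - 1)%C in T by ring.
  rewrite (Cmod_mult Ci), Cmod_Ci, Cmod_R, Rabs_pos_eq in T by lra.
  simpl in *; nra.
Qed.

(** The Cauchy-Riemann equation in finite form. To first order, multiplying z by exp (kappa * th) moves it
    by kappa * th * z, and multiplying by e^(i th) moves it by i * th * z. As the derivative of G is complex
    linear, the radial increment of G is -i * kappa times the angular one, up to O(th^2). *)
Lemma radial_vs_rotation (G : C -> C) (z : C) (K d kappa th : R) :
  0 <= kappa -> 0 <= th <= 1 -> kappa * th <= 1 / 2 -> 0 <= K ->
  2 * th < d -> 2 * (kappa * th) < d ->
  Cmod z <= 1 -> quad_approx_on_ball G K d z ->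
  Cmod (G (RtoC (exp (kappa * th)) * z) - G z + Ci * kappa * (G (cis th * z) - G z))%C
  <= K * (6 * kappa ^ 2 + 5 * kappa) * th ^ 2.
Proof.
  intros Hk Hth Hkt HK Hd1 Hd2 Hz [L [HL HE]].
  set (sg := kappa * th) in *.
  assert (Hsg : 0 <= sg) by (unfold sg; nra).
  pose proof (exp_quad sg ltac:(lra)) as He.
  pose proof (cis_quad th Hth) as Hc; pose proof (cis_minus_1_bound th Hth) as Hc1.
  pose proof (Cmod_ge_0 z) as Hz0.
  assert (He1 : Cmod (RtoC (exp sg) - 1) <= 2 * sg).
  { rewrite <- RtoC_minus, Cmod_R, Rabs_pos_eq; simpl in *; nra. }
  assert (Hm : forall x, Cmod (x * z - z) <= Cmod (x - 1)).
  { intros x; replace (x * z - z)%C with ((x - 1) * z)%C by ring.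
    rewrite Cmod_mult; pose proof (Cmod_ge_0 (x - 1)); nra. }
  pose proof (Hm (RtoC (exp sg))) as M1; pose proof (Hm (cis th)) as M2.
  pose proof (HE (RtoC (exp sg) * z)%C ltac:(lra)) as E1.
  pose proof (HE (cis th * z)%C ltac:(lra)) as E2.
  unfold quad_approx in *.
  set (e := RtoC (exp sg)) in *; set (c := cis th) in *.
  (* the two linear terms cancel up to the second-order errors of exp and cis *)
  replace (G (e * z) - G z + Ci * kappa * (G (c * z) - G z))%C
    with ((G (e * z) - G z - L * (e * z - z)) + Ci * kappa * (G (c * z) - G z - L * (c * z - z))
          + L * z * ((e - 1 - sg) + Ci * kappa * (c - 1 - Ci * th)))%C.
  2:{ unfold sg; rewrite RtoC_mult.
      assert (Hi : (Ci * Ci)%C = RtoC (-1)) by (unfold Ci, Cmult, RtoC; simpl; f_equal; ring).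
      replace (Ci * kappa * (c - 1 - Ci * th))%C
        with (Ci * kappa * (c - 1) - (Ci * Ci) * kappa * th)%C by ring.
      rewrite Hi; replace (RtoC (-1)) with (- (1))%C by (rewrite <- RtoC_opp; f_equal; lra).
      ring. }
  assert (Hik : forall x, Cmod (Ci * kappa * x) = kappa * Cmod x).
  { intros x; rewrite !Cmod_mult, Cmod_Ci, Cmod_R, Rabs_pos_eq by easy; ring. }
  eapply Rle_trans; [apply Cmod_triangle3|]; rewrite Hik.
  assert (S1 : Cmod (e * z - z) ^ 2 <= (2 * sg) ^ 2)
    by (apply pow_incr; split; [apply Cmod_ge_0 | lra]).
  assert (S2 : Cmod (c * z - z) ^ 2 <= (2 * th) ^ 2)
    by (apply pow_incr; split; [apply Cmod_ge_0 | lra]).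
  assert (T1 : K * Cmod (e * z - z) ^ 2 <= K * (2 * sg) ^ 2) by (apply Rmult_le_compat_l; lra).
  assert (T2 : kappa * Cmod (G (c * z)%C - G z - L * (c * z - z)) <= kappa * (K * (2 * th) ^ 2)).
  { apply Rmult_le_compat_l; [easy|].
    eapply Rle_trans; [exact E2 | apply Rmult_le_compat_l; lra]. }
  assert (T3 : Cmod (L * z * (e - 1 - sg + Ci * kappa * (c - 1 - Ci * th)))
               <= K * (2 * sg ^ 2 + kappa * th ^ 2)).
  { rewrite !Cmod_mult.
    assert (A1 : Cmod L * Cmod z <= K) by (pose proof (Cmod_ge_0 L); nra).
    apply Rmult_le_compat; [apply Rmult_le_pos; apply Cmod_ge_0 | apply Cmod_ge_0 | easy |].
    eapply Rle_trans; [apply Cmod_triangle|]; rewrite Hik; apply Rplus_le_compat.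
    - unfold e; rewrite <- !RtoC_minus, Cmod_R, Rabs_pos_eq; lra.
    - now apply Rmult_le_compat_l. }
  apply Rle_trans with (K * (2 * sg) ^ 2 + kappa * (K * (2 * th) ^ 2) + K * (2 * sg ^ 2 + kappa * th ^ 2));
    [lra|].
  right; unfold sg; ring.
Qed.

Lemma circle_point_succ (N j : nat) (rho : R) :
  circle_point N rho (S j) = (cis (2 * PI / INR N) * circle_point N rho j)%C.
Proof.
  unfold circle_point; rewrite S_INR.
  replace ((INR j + 1) * (2 * PI / INR N)) with (INR j * (2 * PI / INR N) + 2 * PI / INR N) by ring.
  rewrite cis_add; ring.
Qed.

(** The rotation permutes the N points cyclically. *)
Lemma circle_mean_rotate (N : nat) (rho : R) (G : C -> C) :
  (0 < N)%nat ->
  circle_mean N rho (fun z => G (cis (2 * PI / INR N) * z))%C = circle_mean N rho G.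
Proof.
  intros HN; unfold circle_mean; f_equal.
  assert (Hsh : forall (u : nat -> C) n,
    csum (fun j => u (S j)) n = (csum u n + u n - u O)%C).
  { intros u n; induction n as [|n IH]; simpl; [ring | rewrite IH; ring]. }
  rewrite (csum_ext _ (fun j => (fun i => G (circle_point N rho i)) (S j)))
    by (intros; now rewrite circle_point_succ).
  rewrite (Hsh (fun i => G (circle_point N rho i))).
  assert (E : circle_point N rho N = circle_point N rho 0).
  { unfold circle_point; simpl INR.
    replace (INR N * (2 * PI / INR N)) with (2 * PI) by (field; apply not_0_INR; lia).
    now rewrite Rmult_0_l, cis_2PI, cis_0. }
  rewrite E; ring.
Qed.

Lemma exp_INR_mult (x : R) (n : nat) : exp x ^ n = exp (INR n * x).
Proof.
  induction n as [|n IH]; [simpl; now rewrite Rmult_0_l, exp_0|].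
  simpl pow; rewrite IH, <- exp_plus, S_INR; f_equal; ring.
Qed.

(** A discrete form of Cauchy's theorem. The ratio r2 / r1 is split into N equal factors e. In one step
    the mean of the radial increments equals, up to O(1 / N^2), a multiple of the mean of the angular
    increments, which is 0 by [circle_mean_rotate]. The N steps add up to an error O(1 / N). *)
Lemma circle_mean_radius (G : C -> C) (r1 r2 eps : R) :
  0 < r1 -> r1 <= r2 -> r2 <= 1 -> 0 < eps ->
  (forall z, r1 <= Cmod z <= r2 -> regular_at G z) ->
  exists N0, forall N, (N0 <= N)%nat ->
    Cmod (circle_mean N r2 G - circle_mean N r1 G) <= eps.
Proof.
  intros Hr1 Hr12 Hr2 Heps HG.
  destruct (uniform_quad_approx G r1 r2 Hr2 HG) as [d [K [Hd [HK HU]]]].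
  pose proof PI_RGT_0 as Hpi.
  set (lam := ln (r2 / r1)).
  assert (Hlam : 0 <= lam).
  { unfold lam; rewrite <- ln_1; apply Rcomplements.ln_le; [lra|].
    apply Rle_div_r; lra. }
  assert (Hexp : r1 * exp lam = r2).
  { unfold lam; rewrite exp_ln; [field; lra | apply Rdiv_lt_0_compat; lra]. }
  (* kappa is chosen so that N steps of kappa * (2 PI / N) make up ln (r2 / r1) *)
  set (kappa := lam / (2 * PI)).
  assert (Hka : 0 <= kappa) by (apply Rdiv_le_0_compat; lra).
  set (D := K * (6 * kappa ^ 2 + 5 * kappa) * (2 * PI) ^ 2).
  assert (HD : 0 <= D).
  { apply Rmult_le_pos; [|apply pow2_ge_0]; apply Rmult_le_pos; [easy|].
    pose proof (pow2_ge_0 kappa); lra. }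
  assert (Hbig : forall x, exists N, x < INR N).
  { intros x; destruct (Rle_dec 0 x) as [Hx|Hx].
    - destruct (nfloor_ex x Hx) as [n Hn]; exists (S n); rewrite S_INR; lra.
    - exists O; simpl; lra. }
  destruct (Hbig (2 * PI + 2 * lam + 4 * PI / d + 2 * lam / d + D / eps)) as [N0 HN0].
  exists N0; intros N HN; apply le_INR in HN.
  assert (0 <= 4 * PI / d) by (apply Rdiv_le_0_compat; lra).
  assert (0 <= 2 * lam / d) by (apply Rdiv_le_0_compat; lra).
  assert (0 <= D / eps) by (apply Rdiv_le_0_compat; lra).
  assert (HNp : 0 < INR N) by lra.
  assert (HN0' : (0 < N)%nat) by (apply INR_lt; simpl; lra).
  set (th := 2 * PI / INR N).
  assert (Hth : 0 <= th) by (apply Rdiv_le_0_compat; lra).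
  assert (Hkt : kappa * th = lam / INR N) by (unfold kappa, th; field; lra).
  assert (Hth1 : th <= 1) by (apply Rle_div_l; lra).
  assert (Hkt1 : kappa * th <= 1 / 2) by (rewrite Hkt; apply Rle_div_l; lra).
  assert (Hthd : 2 * th < d).
  { assert (H3 : 4 * PI / d < INR N) by lra; apply Rlt_div_l in H3; [|lra].
    replace (2 * th) with (4 * PI / INR N) by (unfold th; field; lra).
    apply Rlt_div_l; lra. }
  assert (Hktd : 2 * (kappa * th) < d).
  { assert (H3 : 2 * lam / d < INR N) by lra; apply Rlt_div_l in H3; [|lra].
    rewrite Hkt; replace (2 * (lam / INR N)) with (2 * lam / INR N) by (field; lra).
    apply Rlt_div_l; lra. }
  set (e := exp (kappa * th)).
  assert (Hstep : forall rho, r1 <= rho <= r2 ->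
    Cmod (circle_mean N (e * rho) G - circle_mean N rho G) <= D / INR N ^ 2).
  { intros rho Hrho.
    replace (circle_mean N (e * rho) G - circle_mean N rho G)%C
      with (circle_mean N rho (fun z => G (RtoC e * z) - G z
                                        + Ci * kappa * (G (cis th * z) - G z)))%C.
    - replace (D / INR N ^ 2) with (K * (6 * kappa ^ 2 + 5 * kappa) * th ^ 2)
        by (unfold D, th; field; lra).
      apply circle_mean_bound; [easy | lra |]; intros z Hz.
      apply radial_vs_rotation with d; auto; [lra|].
      apply HU; lra.
    - pose proof (circle_mean_rotate N rho G HN0') as Hrot; fold th in Hrot.
      replace (circle_mean N (e * rho) G) with (circle_mean N rho (fun z => G (RtoC e * z)%C)).
      2:{ unfold circle_mean; f_equal; apply csum_ext; intros j _; f_equal.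
          unfold circle_point; rewrite RtoC_mult; ring. }
      set (A := circle_mean N rho (fun z => G (RtoC e * z)%C)) in *.
      transitivity (A - circle_mean N rho G + Ci * kappa
        * (circle_mean N rho (fun z => G (cis th * z)%C) - circle_mean N rho G))%C.
      + unfold A, circle_mean.
        set (u := fun j => G (RtoC e * circle_point N rho j)%C).
        set (v := fun j => G (circle_point N rho j)).
        set (w := fun j => G (cis th * circle_point N rho j)%C).
        rewrite (csum_ext _ (fun j => (u j + (- (1) - Ci * kappa) * v j) + (Ci * kappa) * w j)%C)
          by (intros; unfold u, v, w; ring).
        rewrite csum_plus, csum_plus, !csum_scal; ring.
      + rewrite Hrot; ring. }
  assert (Hit : forall j, (j <= N)%nat ->
    Cmod (circle_mean N (e ^ j * r1) G - circle_mean N r1 G) <= INR j * (D / INR N ^ 2)).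
  { assert (He1 : 1 <= e) by (unfold e; pose proof (exp_ineq1_le (kappa * th)); nra).
    assert (HeN : e ^ N * r1 = r2).
    { unfold e; rewrite exp_INR_mult, Hkt.
      replace (INR N * (lam / INR N)) with lam by (field; lra); lra. }
    induction j as [|j IH]; intros Hj.
    - simpl; rewrite Rmult_1_l.
      set (m := circle_mean N r1 G); replace (m - m)%C with (RtoC 0) by ring; rewrite Cmod_0; lra.
    - specialize (IH ltac:(lia)).
      assert (Hrho : r1 <= e ^ j * r1 <= r2).
      { pose proof (pow_R1_Rle e j He1); split; [nra|].
        rewrite <- HeN; apply Rmult_le_compat_r; [lra|].
        apply Rle_pow; [easy | lia]. }
      specialize (Hstep _ Hrho).
      rewrite S_INR; replace (e ^ S j * r1) with (e * (e ^ j * r1)) by (simpl; ring).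
      set (m2 := circle_mean N (e * _) G) in *; set (m1 := circle_mean N (e ^ j * r1) G) in *.
      set (m0 := circle_mean N r1 G) in *.
      replace (m2 - m0)%C with ((m2 - m1) + (m1 - m0))%C by ring.
      eapply Rle_trans; [apply Cmod_triangle | lra]. }
  specialize (Hit N (Nat.le_refl _)).
  replace (e ^ N * r1) with r2 in Hit.
  2:{ unfold e; rewrite exp_INR_mult, Hkt.
      replace (INR N * (lam / INR N)) with lam by (field; lra); lra. }
  eapply Rle_trans; [exact Hit|].
  replace (INR N * (D / INR N ^ 2)) with (D / INR N) by (field; lra).
  apply Rle_div_l; [easy|].
  assert (H3 : D / eps <= INR N) by lra; apply Rle_div_l in H3; lra.
Qed.

Lemma bernoulli (x : R) (n : nat) : 0 <= x <= 1 -> 1 - INR n * x <= (1 - x) ^ n.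
Proof.
  intros Hx; induction n as [|n IH]; [simpl; lra|].
  rewrite S_INR; simpl; pose proof (pos_INR n).
  assert (0 <= (1 - x) ^ n) by (apply pow_le; lra).
  assert (0 <= INR n * x) by (apply Rmult_le_pos; lra).
  nra.
Qed.

(** As / 0 = 0, the identity / z^n = (/ z)^n holds at every z. *)
Lemma regular_at_inv_pow (z0 : C) (n : nat) :
  z0 <> RtoC 0 -> regular_at (fun z => / z ^ n)%C z0.
Proof.
  intros H0.
  replace (fun z => / z ^ n)%C with (fun z => (/ z) ^ n)%C.
  - now apply regular_at_pow, regular_at_inv.
  - apply functional_extensionality; intros z.
    destruct (Ceq_dec z 0) as [->|Hz]; [|now apply Cpow_inv].
    assert (E : (/ 0)%C = RtoC 0).
    { unfold Cinv, RtoC; simpl; f_equal; unfold Rdiv; ring. }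
    rewrite E; destruct n as [|n]; [|rewrite Cpow_S, Cmult_0_l, E; easy].
    simpl; rewrite <- RtoC_inv by lra; now rewrite Rinv_1.
Qed.

(** F is only known to be the sum of this series near 0. The means of F z / z^n over a small circle tend to
    the coefficient, and those over a circle of radius r2 < 1 are at most 1 / r2^n; by
    [circle_mean_radius] the difference of the two tends to 0. *)
Lemma bounded_coeff (t : R) (u : nat -> C) (F : C -> C) (n : nat) :
  0 < t -> sums_on t u F ->
  (forall z, Cmod z < 1 -> regular_at F z) ->
  (forall z, Cmod z < 1 -> Cmod (F z) <= 1) ->
  Cmod (u n) <= 1.
Proof.
  intros Ht Hu Hreg Hb.
  assert (Hrho : forall r2, 0 < r2 < 1 -> Cmod (u n) * r2 ^ n <= 1).
  { intros r2 Hr2.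
    set (r1 := Rmin r2 (t / 2)).
    assert (Hr1 : 0 < r1) by (apply Rmin_pos; lra).
    assert (H12 : r1 <= r2) by apply Rmin_l.
    assert (H1t : r1 <= t / 2) by apply Rmin_r.
    assert (Hrn : 0 < r2 ^ n) by (apply pow_lt; lra).
    apply Rle_div_r; [easy|]; apply le_epsilon; intros eps Heps.
    set (G := fun z => (F z / z ^ n)%C).
    destruct (circle_mean_coeff t r1 u F n (eps / 2) Hu) as [N1 H1]; [lra | lra |].
    destruct (circle_mean_radius G r1 r2 (eps / 2)) as [N2 H2]; [lra | lra | lra | lra | |].
    { intros z Hz; apply regular_at_mult; [apply Hreg; lra|].
      apply regular_at_inv_pow, Cmod_gt_0; lra. }
    specialize (H1 (S (N1 + N2)) ltac:(lia)); specialize (H2 (S (N1 + N2)) ltac:(lia)).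
    fold G in H1.
    assert (HB : Cmod (circle_mean (S (N1 + N2)) r2 G) <= 1 / r2 ^ n).
    { apply circle_mean_bound; [lia | lra |]; intros z Hz; unfold G.
      rewrite Cmod_div, Cmod_pow, Hz by (apply Cpow_nz, Cmod_gt_0; lra).
      apply Rmult_le_compat_r; [left; now apply Rinv_0_lt_compat | apply Hb; lra]. }
    set (m1 := circle_mean _ r1 G) in *; set (m2 := circle_mean _ r2 G) in *.
    pose proof (Cmod_triangle3 m2 (- (m2 - m1)) (- (m1 - u n))) as T.
    rewrite !Cmod_opp in T.
    replace (m2 + - (m2 - m1) + - (m1 - u n))%C with (u n) in T by ring; lra. }
  pose proof (Cmod_ge_0 (u n)) as H0.
  (* letting r2 = 1 - x tend to 1 *)
  apply le_epsilon; intros eps Heps.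
  pose proof (pos_INR n) as Hn0.
  set (A := Cmod (u n)) in *.
  set (x := Rmin (1 / 2) (eps / (A * INR n + 1))).
  assert (HAn : 0 <= A * INR n) by now apply Rmult_le_pos.
  assert (Hx : 0 < x) by (apply Rmin_pos; [lra | apply Rdiv_lt_0_compat; lra]).
  assert (Hx1 : x <= 1 / 2) by apply Rmin_l.
  assert (Hx2 : x <= eps / (A * INR n + 1)) by apply Rmin_r.
  apply Rle_div_r in Hx2; [|lra].
  specialize (Hrho (1 - x) ltac:(lra)).
  pose proof (bernoulli x n ltac:(lra)) as HB.
  assert (A * (1 - INR n * x) <= A * (1 - x) ^ n) by (apply Rmult_le_compat_l; lra).
  nra.
Qed.

(** * Powers of power series *)

Lemma has_sum_prepend (u : nat -> C) (l : C) (n : nat) :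
  (forall k, (k < n)%nat -> u k = RtoC 0) ->
  has_sum (fun k => u (n + k)%nat) l -> has_sum u l.
Proof.
  intros H0 H eps Heps; destruct (H eps Heps) as [N HN]; exists (n + N)%nat; intros p Hp.
  specialize (HN (p - n)%nat ltac:(lia)).
  replace p with (n + (p - n))%nat by lia.
  rewrite csum_add, (csum_zero u n H0), Cplus_0_l; exact HN.
Qed.

Lemma sums_on_ext (t : R) (u : nat -> C) (F G : C -> C) :
  (forall z, Cmod z < t -> F z = G z) -> sums_on t u F -> sums_on t u G.
Proof. intros E H z Hz; rewrite <- E by easy; now apply H. Qed.

Lemma sums_on_unique (s t : R) (u : nat -> C) (F G : C -> C) (z : C) :
  sums_on s u F -> sums_on t u G -> Cmod z < s -> Cmod z < t -> F z = G z.
Proof. intros HF HG Hs Ht; exact (has_sum_unique _ _ _ (HF z Hs) (HG z Ht)). Qed.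

Lemma has_sum_at_0 (u : nat -> C) : has_sum (fun k => u k * 0 ^ k)%C (u O).
Proof.
  replace (u O) with (csum (fun k => u k * 0 ^ k)%C 1) by (simpl; ring).
  apply has_sum_finite; intros [|k] Hk; [lia|]; rewrite Cpow_S; ring.
Qed.

(** The coefficients of the k-th power of the power series with coefficients v. *)
Fixpoint fpow (v : nat -> C) (k : nat) : nat -> C :=
  match k with
  | O => fun n => match n with O => RtoC 1 | S _ => RtoC 0 end
  | S k' => conv v (fpow v k')
  end.

Lemma sums_on_fpow (t : R) (v : nat -> C) (F : C -> C) (k : nat) :
  sums_on t v F -> sums_on t (fpow v k) (fun z => F z ^ k)%C.
Proof.
  intros H; induction k as [|k IH].
  - intros z _; replace (F z ^ 0)%C with (csum (fun n => fpow v 0 n * z ^ n)%C 1)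
      by (simpl; ring).
    apply has_sum_finite; intros [|n] Hn; [lia | simpl; ring].
  - exact (sums_on_mult t v (fpow v k) F _ H IH).
Qed.

Lemma fpow_1 (v : nat -> C) (n : nat) : fpow v 1 n = v n.
Proof.
  simpl; unfold conv; rewrite (csum_single _ (S n) n); [|lia|].
  - rewrite Nat.sub_diag; ring.
  - intros k Hk Hne; destruct (n - k)%nat eqn:E; [lia | ring].
Qed.

(** Multiplication of a power series by z^k. *)
Definition shift (k : nat) (u : nat -> C) (n : nat) : C :=
  if (n <? k)%nat then RtoC 0 else u (n - k)%nat.

Lemma shift_lt (k n : nat) (u : nat -> C) : (n < k)%nat -> shift k u n = RtoC 0.
Proof. intros H; unfold shift; now apply Nat.ltb_lt in H as ->. Qed.

Lemma shift_add (k n : nat) (u : nat -> C) : shift k u (k + n) = u n.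
Proof.
  unfold shift; replace (k + n <? k)%nat with false by (symmetry; apply Nat.ltb_ge; lia).
  f_equal; lia.
Qed.

Lemma sums_on_shift (t : R) (u : nat -> C) (F : C -> C) (k : nat) :
  sums_on t u F -> sums_on t (shift k u) (fun z => z ^ k * F z)%C.
Proof.
  intros H z Hz; apply has_sum_prepend with k.
  - intros n Hn; rewrite shift_lt by easy; ring.
  - apply has_sum_ext with (fun n => z ^ k * (u n * z ^ n))%C.
    + intros n; rewrite shift_add, Cpow_add_r; ring.
    + now apply has_sum_scal, H.
Qed.

Lemma rsum_bounded_coeff (u : nat -> C) (B : R) (z : C) (n : nat) :
  (forall k, Cmod (u k) <= B) -> Cmod z < 1 ->
  rsum (fun k => Cmod (u k * z ^ k)) n <= B * / (1 - Cmod z).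
Proof.
  intros Hu Hz; pose proof (Cmod_ge_0 z).
  assert (0 <= B) by (pose proof (Cmod_ge_0 (u O)); specialize (Hu O); lra).
  apply Rle_trans with (B * rsum (fun k => Cmod z ^ k) n).
  - rewrite <- rsum_scal; apply rsum_le; intros k _.
    rewrite Cmod_mult, Cmod_pow.
    apply Rmult_le_compat_r; [apply pow_le; lra | apply Hu].
  - apply Rmult_le_compat_l; [easy | apply rsum_geom; lra].
Qed.

Lemma sums_on_bounded_coeff (u : nat -> C) (B : R) :
  (forall k, Cmod (u k) <= B) -> exists F, sums_on 1 u F.
Proof.
  intros Hu.
  exists (fun z => epsilon (inhabits (RtoC 0)) (fun l => has_sum (fun k => u k * z ^ k)%C l)).
  intros z Hz; apply epsilon_spec.
  apply has_sum_of_abs with (B * / (1 - Cmod z)); intros n.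
  now apply rsum_bounded_coeff.
Qed.

Lemma le_1_of_bounded_powers (x B : R) : 0 <= x -> (forall k, x ^ k <= B) -> x <= 1.
Proof.
  intros Hx H; apply Rnot_lt_le; intros Hlt.
  destruct (Pow_x_infinity x) with (b := B + 1) as [N HN]; [rewrite Rabs_pos_eq; lra|].
  specialize (HN N (Nat.le_refl _)); rewrite Rabs_pos_eq in HN by (now apply pow_le).
  specialize (H N); lra.
Qed.

(** * Schwarz's lemma and composition *)

(** Schwarz's lemma for omega = z phi, where phi is the sum of a power series on the whole disk. The
    factorization is claimed near 0 only, which is enough to compare Taylor coefficients at 0 and avoids
    analytic continuation. The k-th power of omega is bounded by 1, so its coefficients, which are those
    of phi^k shifted by k, are bounded by 1. Hence |phi z|^k <= 1 / (1 - |z|) for every k, which forces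
    |phi z| <= 1. *)
Lemma schwarz (omega : C -> C) :
  analytic_in_disk omega -> (forall z, Cmod z < 1 -> Cmod (omega z) <= 1) ->
  omega (RtoC 0) = RtoC 0 ->
  exists (t : R) (v : nat -> C) (phi : C -> C),
    0 < t /\ (forall z, Cmod z < t -> omega z = (z * phi z)%C) /\
    sums_on 1 v phi /\ (forall z, Cmod z < 1 -> Cmod (phi z) <= 1) /\
    (forall k j, Cmod (fpow v k j) <= 1).
Proof.
  intros Han Hb H0.
  destruct (analytic_at_sums_on omega 0) as [t [w [Ht Hw]]]; [apply Han; rewrite Cmod_0; lra|].
  assert (Hw' : sums_on t w omega).
  { revert Hw; apply sums_on_ext; intros z _; f_equal; ring. }
  assert (Hw0 : w O = RtoC 0).
  { rewrite <- H0; apply (has_sum_unique _ _ _ (has_sum_at_0 w)), Hw'; rewrite Cmod_0; lra. }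
  set (v := fun j => w (S j)).
  set (phi := fun z => if Ceq_dec z 0 then v O else (omega z / z)%C).
  assert (Hphi : sums_on t v phi).
  { intros z Hz; unfold phi; destruct (Ceq_dec z 0) as [->|Hz0]; [apply has_sum_at_0|].
    pose proof (has_sum_tail _ _ 1 (Hw' z Hz)) as Hs.
    apply (has_sum_scal (/ z)) in Hs.
    simpl csum in Hs; rewrite Hw0 in Hs.
    replace (omega z / z)%C with (/ z * (omega z - (0 + 0 * z ^ 0)))%C by (simpl; field; easy).
    revert Hs; apply has_sum_ext; intros k; unfold v; simpl; field; easy. }
  assert (Hfac : forall z, omega z = (z * phi z)%C).
  { intros z; unfold phi; destruct (Ceq_dec z 0) as [->|Hz0]; [rewrite H0; ring | field; easy]. }
  assert (Hcoef : forall k j, Cmod (fpow v k j) <= 1).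
  { intros k j; rewrite <- (shift_add k j).
    apply (bounded_coeff t _ (fun z => omega z ^ k)%C); [easy | | |].
    - eapply sums_on_ext; [|apply sums_on_shift, sums_on_fpow, Hphi].
      intros z _; cbv beta; now rewrite Hfac, Cpow_mult_l.
    - intros z Hz; apply regular_at_pow, analytic_regular_at, Han, Hz.
    - intros z Hz; rewrite Cmod_pow, <- (pow1 k).
      apply pow_incr; split; [apply Cmod_ge_0 | auto]. }
  destruct (sums_on_bounded_coeff v 1) as [psi Hpsi].
  { intros k; rewrite <- fpow_1; apply Hcoef. }
  exists (Rmin t 1), v, psi.
  split; [apply Rmin_pos; lra|].
  split.
  { intros z Hz; rewrite Hfac; f_equal.
    pose proof (Rmin_l t 1); pose proof (Rmin_r t 1).
    apply (sums_on_unique t 1 v); auto; lra. }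
  split; [easy|]; split; [|easy].
  intros z Hz; apply le_1_of_bounded_powers with (1 * / (1 - Cmod z)); [apply Cmod_ge_0|].
  intros k; rewrite <- Cmod_pow.
  apply (Cmod_has_sum_le _ _ _ (sums_on_fpow 1 v psi k Hpsi z Hz)).
  intros n; now apply rsum_bounded_coeff.
Qed.

Lemma sums_on_csum (t : R) (d : nat -> C) (u : nat -> nat -> C) (F : nat -> C -> C) (N : nat) :
  (forall k, sums_on t (u k) (F k)) ->
  sums_on t (fun j => csum (fun k => d k * u k j)%C N) (fun z => csum (fun k => d k * F k z)%C N).
Proof.
  intros H z Hz; induction N as [|N IH]; simpl.
  - apply (has_sum_finite (fun k => 0 * z ^ k)%C 0); intros; ring.
  - apply has_sum_ext with (fun j => csum (fun k => d k * u k j)%C N * z ^ j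
                                     + d N * (u N j * z ^ j))%C; [intros; ring|].
    apply has_sum_plus; [easy | apply has_sum_scal; now apply H].
Qed.

(** Cauchy's estimate at radius rho gives |u n| <= M rho^(N - n), and rho may tend to 0. *)
Lemma coeff_zero_of_order (t M : R) (u : nat -> C) (F : C -> C) (n N : nat) :
  0 < t -> sums_on t u F -> (n < N)%nat ->
  (forall z, Cmod z < t -> Cmod (F z) <= M * Cmod z ^ N) -> u n = RtoC 0.
Proof.
  intros Ht Hu HnN HM.
  apply Cmod_eq_0, Rle_antisym; [|apply Cmod_ge_0].
  apply le_epsilon; intros eps Heps; rewrite Rplus_0_l.
  set (rho := Rmin (Rmin (t / 2) 1) (eps / (Rabs M + 1))).
  pose proof (Rabs_pos M) as HaM.
  assert (Hrho : 0 < rho) by (repeat apply Rmin_pos; try lra; apply Rdiv_lt_0_compat; lra).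
  assert (H1 : rho <= Rmin (t / 2) 1) by apply Rmin_l.
  assert (H2 : rho <= eps / (Rabs M + 1)) by apply Rmin_r.
  pose proof (Rmin_l (t / 2) 1); pose proof (Rmin_r (t / 2) 1).
  apply Rle_div_r in H2; [|lra].
  assert (Hrn : 0 < rho ^ n) by now apply pow_lt.
  apply Rmult_le_reg_r with (rho ^ n); [easy|].
  eapply Rle_trans; [apply (cauchy_estimate t rho (eps * rho ^ n) u F n Hu); [lra|]|lra].
  intros z Hz; eapply Rle_trans; [apply HM; lra|]; rewrite Hz.
  assert (EN : rho ^ N = rho ^ n * (rho * rho ^ (N - n - 1))).
  { replace N with (n + S (N - n - 1))%nat at 1 by lia; apply pow_add. }
  rewrite EN.
  assert (Hq : 0 <= rho ^ (N - n - 1) <= 1).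
  { split; [apply pow_le; lra|]; rewrite <- (pow1 (N - n - 1)); apply pow_incr; lra. }
  pose proof (Rle_abs M).
  assert (M * (rho * rho ^ (N - n - 1)) <= eps).
  { apply Rle_trans with (Rabs M * (rho * 1)); [|nra].
    apply Rle_trans with (Rabs M * (rho * rho ^ (N - n - 1))).
    - apply Rmult_le_compat_r; [apply Rmult_le_pos; lra | easy].
    - apply Rmult_le_compat_l; [easy|]; apply Rmult_le_compat_l; lra. }
  nra.
Qed.

(** Since omega z = z * phi z vanishes at 0, replacing the series of G (omega z) by its partial sum changes it
    by O(z^N), hence does not affect the coefficients of degree less than N. This replaces a rearrangement
    of a double series. *)
Lemma composition_coeff (t : R) (alpha d v : nat -> C) (F G phi : C -> C) (n N : nat) :
  0 < t -> sums_on 1 alpha F -> sums_on 1 d G -> sums_on 1 v phi ->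
  (forall z, Cmod z < 1 -> Cmod (phi z) <= 1) ->
  (forall z, Cmod z < t -> F z = G (z * phi z)%C) ->
  (n < N)%nat ->
  alpha n = csum (fun k => d k * shift k (fpow v k) n)%C N.
Proof.
  intros Ht Ha Hd Hv Hphi HFG HnN.
  destruct (sums_on_abs 1 d G (1 / 2) Hd) as [M [HM0 HM]]; [lra|].
  set (s := Rmin t (1 / 2)).
  assert (Hs : 0 < s) by (apply Rmin_pos; lra).
  assert (Hst : s <= t) by apply Rmin_l.
  assert (Hs2 : s <= 1 / 2) by apply Rmin_r.
  set (P := fun z => csum (fun k => d k * (z ^ k * phi z ^ k))%C N).
  set (beta := fun j => csum (fun k => d k * shift k (fpow v k) j)%C N).
  assert (HP : sums_on 1 beta P).
  { apply (sums_on_csum 1 d (fun k => shift k (fpow v k)) (fun k z => z ^ k * phi z ^ k)%C).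
    intros k; now apply sums_on_shift, sums_on_fpow. }
  enough (E : (alpha n + - (1) * beta n)%C = RtoC 0).
  { change (alpha n = beta n); replace (alpha n) with ((alpha n + - (1) * beta n) + beta n)%C by ring.
    rewrite E; ring. }
  apply (coeff_zero_of_order s (M * 2 ^ N) (fun j => alpha j + - (1) * beta j)%C
           (fun z => F z + - (1) * P z)%C n N Hs); [|easy|].
  - intros z Hz.
    apply has_sum_ext with (fun k => alpha k * z ^ k + - (1) * (beta k * z ^ k))%C;
      [intros; ring|].
    apply has_sum_plus; [apply Ha; lra | apply has_sum_scal, HP; lra].
  - intros z Hz; set (y := (z * phi z)%C).
    assert (Hy : Cmod y <= Cmod z).
    { unfold y; rewrite Cmod_mult; pose proof (Cmod_ge_0 z); specialize (Hphi z ltac:(lra)); nra. }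
    rewrite HFG by lra; fold y.
    replace (G y + - (1) * P z)%C with (G y - csum (fun k => d k * y ^ k)%C N)%C.
    2:{ unfold P; rewrite (csum_ext (fun k => d k * (z ^ k * phi z ^ k))%C
                             (fun k => d k * y ^ k)%C); [ring|].
        intros k _; unfold y; now rewrite Cpow_mult_l. }
    apply (Cmod_has_sum_le (fun k => d (N + k)%nat * y ^ (N + k))%C).
    { apply (has_sum_tail (fun k => d k * y ^ k)%C), Hd; lra. }
    intros p.
    apply Rle_trans with (Cmod z ^ N * 2 ^ N
        * rsum (fun k => Cmod (d (N + k)%nat) * (1 / 2) ^ (N + k)) p).
    + rewrite <- rsum_scal; apply rsum_le; intros k _.
      rewrite Cmod_mult, Cmod_pow, !pow_add.
      assert (Hh : 2 ^ N * (1 / 2) ^ N = 1).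
      { rewrite <- Rpow_mult_distr; replace (2 * (1 / 2)) with 1 by field; apply pow1. }
      replace (Cmod z ^ N * 2 ^ N * (Cmod (d (N + k)%nat) * ((1 / 2) ^ N * (1 / 2) ^ k)))
        with (Cmod (d (N + k)%nat) * (Cmod z ^ N * (2 ^ N * (1 / 2) ^ N) * (1 / 2) ^ k)) by ring.
      rewrite Hh, Rmult_1_r.
      pose proof (Cmod_ge_0 y).
      apply Rmult_le_compat_l; [apply Cmod_ge_0|].
      apply Rmult_le_compat; try apply pow_le; try lra; apply pow_incr; lra.
    + rewrite (Rmult_comm (M * 2 ^ N)), (Rmult_comm M), <- Rmult_assoc.
      apply Rmult_le_compat_l.
      { apply Rmult_le_pos; apply pow_le; [apply Cmod_ge_0 | lra]. }
      specialize (HM (N + p)%nat); rewrite rsum_add in HM.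
      assert (0 <= rsum (fun k => Cmod (d k) * (1 / 2) ^ k) N).
      { apply rsum_nonneg; intros; apply Rmult_le_pos; [apply Cmod_ge_0 | apply pow_le; lra]. }
      lra.
Qed.

(** * Majorants and the Bohr radius *)

Lemma majorant_terms_nonneg (r : R) (u : nat -> C) (n : nat) : 0 <= r -> 0 <= Cmod (u n) * r ^ n.
Proof. intros Hr; apply Rmult_le_pos; [apply Cmod_ge_0 | now apply pow_le]. Qed.

Lemma rsum_le_majorant (r : R) (u : nat -> C) (N : nat) :
  0 <= r -> Rbar_le (rsum (fun n => Cmod (u n) * r ^ n) N) (majorant r u).
Proof.
  intros Hr; rewrite <- (Lim_seq_const (rsum _ N)); apply Lim_seq_le_loc.
  exists N; intros n Hn; rewrite sum_n_rsum.
  apply rsum_mono; [intros; now apply majorant_terms_nonneg | lia].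
Qed.

Lemma majorant_le (r : R) (u : nat -> C) (B : Rbar) :
  (forall N, Rbar_le (rsum (fun n => Cmod (u n) * r ^ n) N) B) -> Rbar_le (majorant r u) B.
Proof.
  intros H; destruct B as [B| |].
  - rewrite <- (Lim_seq_const B); apply Lim_seq_le_loc.
    exists O; intros n _; rewrite sum_n_rsum; exact (H (S n)).
  - destruct (majorant r u); exact I.
  - destruct (H O).
Qed.

Lemma psum_eq (u : nat -> C) (z l : C) : has_sum (fun k => u k * z ^ k)%C l -> psum u z = l.
Proof.
  intros H; unfold psum.
  apply (@iota_unique C_AbsRing C_CompleteNormedModule
           (fun l => @is_pseries C_AbsRing C_NormedModule u z l)).
  - intros y Hy; apply is_pseries_has_sum in Hy; exact (has_sum_unique _ _ _ Hy H).
  - now apply is_pseries_has_sum.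
Qed.

Lemma sums_on_psum (u : nat -> C) : converges_in_disk u -> sums_on 1 u (psum u).
Proof.
  intros H z Hz; destruct (H z Hz) as [l Hl]; apply is_pseries_has_sum in Hl.
  now rewrite (psum_eq u z l Hl).
Qed.

Lemma converges_of_sums_on (u : nat -> C) (F : C -> C) : sums_on 1 u F -> converges_in_disk u.
Proof. intros H z Hz; exists (F z); apply is_pseries_has_sum; now apply H. Qed.

Lemma disk_norm_le (u : nat -> C) (F : C -> C) (B : R) :
  sums_on 1 u F -> (forall z, Cmod z < 1 -> Cmod (F z) <= B) ->
  Rbar_le (disk_norm (psum u)) B.
Proof.
  intros HF HB; unfold disk_norm.
  apply (proj2 (Lub_Rbar_correct _)); intros x [z [Hz ->]].
  rewrite (psum_eq u z (F z)); [exact (HB z Hz) | now apply HF].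
Qed.

(** T annihilates every multiple x z^m, so admissibility forces |x| R0^m <= 1 for every x. *)
Lemma bohr_zero_lead (m : nat) (c : nat -> C) (R0 : R) :
  bohr_admissible m c R0 -> c m = RtoC 0 -> R0 = 0 /\ (0 < m)%nat.
Proof.
  intros [HR0 Hb] Hcm.
  enough (E : R0 ^ m = 0).
  { split; [destruct (Req_dec R0 0); [easy | now apply pow_nonzero with (n := m) in H]|].
    destruct m; [simpl in E; lra | lia]. }
  apply NNPP; intros Hne.
  assert (Hp : 0 < R0 ^ m) by (pose proof (pow_le R0 m HR0); lra).
  set (x := 2 / R0 ^ m).
  set (f := fun n => if (n =? m)%nat then RtoC x else RtoC 0).
  assert (Hf0 : forall n, n <> m -> f n = RtoC 0).
  { intros n Hn; unfold f; now apply Nat.eqb_neq in Hn as ->. }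
  assert (HA : sums_on 1 (A_op m c f) (fun _ => RtoC 0)).
  { intros z _; apply (has_sum_finite (fun k => A_op m c f k * z ^ k)%C 0).
    intros k _; unfold A_op, hadamard.
    destruct (Nat.eq_dec (k + m) m) as [E|E]; [rewrite E, Hcm; ring | rewrite Hf0 by easy; ring]. }
  assert (Hmaj : Rbar_le (majorant R0 f) 1).
  { apply Hb; [split | now apply converges_of_sums_on with (fun _ => RtoC 0) | | lra].
    - intros n Hn; apply Hf0; lia.
    - exists 1; split; [lra|]; intros z _.
      eexists; apply is_pseries_has_sum, (has_sum_finite _ (S m)).
      intros k Hk; rewrite Hf0 by lia; ring.
    - apply disk_norm_le with (fun _ => RtoC 0); [easy|]; intros; rewrite Cmod_0; lra. }
  pose proof (Rbar_le_trans _ _ _ (rsum_le_majorant R0 f (S m) HR0) Hmaj) as H; simpl Rbar_le in H.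
  pose proof (rsum_ge_term (fun n => Cmod (f n) * R0 ^ n) m
                (fun n => majorant_terms_nonneg R0 f n HR0)) as H2; cbv beta in H2.
  unfold f at 1 in H2; rewrite Nat.eqb_refl, Cmod_R, Rabs_pos_eq in H2
    by (unfold x; apply Rdiv_le_0_compat; lra).
  replace (x * R0 ^ m) with 2 in H2 by (unfold x; field; lra).
  simpl in *; lra.
Qed.

(** The left side is a partial sum of the majorant series of the preimage under T of F, which the Bohr
    radius controls because F is bounded by 1. *)
Lemma bohr_preimage (m : nat) (c u : nat -> C) (F : C -> C) (R0 r : R) (N : nat) :
  bohr_admissible m c R0 -> 0 <= r <= R0 ->
  c m <> RtoC 0 ->
  (forall j, Cmod (c m) <= Cmod (c (m + j)%nat)) ->
  sums_on 1 u F -> (forall z, Cmod z < 1 -> Cmod (F z) <= 1) -> (forall j, Cmod (u j) <= 1) ->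
  rsum (fun j => Cmod (u j) / Cmod (c (m + j)%nat) * r ^ (m + j)) N <= 1.
Proof.
  intros [HR0 Hb] Hr Hcm Hc HF HB Hu.
  apply Cmod_gt_0 in Hcm.
  assert (Hc0 : forall j, c (m + j)%nat <> RtoC 0)
    by (intros j; apply Cmod_gt_0; specialize (Hc j); lra).
  set (f := shift m (fun j => u j / c (m + j)%nat)%C).
  assert (HAf : A_op m c f = u).
  { apply functional_extensionality; intros j; unfold A_op, hadamard, f.
    rewrite (Nat.add_comm j m), shift_add; field; apply Hc0. }
  assert (Hmaj : Rbar_le (majorant r f) 1).
  { apply Hb; [split | | | easy].
    - intros n Hn; now apply shift_lt.
    - destruct (sums_on_bounded_coeff f (/ Cmod (c m))) as [G HG].
      + intros n; destruct (Nat.lt_ge_cases n m) as [Hn|Hn].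
        * unfold f; rewrite shift_lt, Cmod_0 by easy; left; now apply Rinv_0_lt_compat.
        * replace n with (m + (n - m))%nat by lia; unfold f; rewrite shift_add.
          rewrite Cmod_div by apply Hc0.
          apply Rle_trans with (1 * / Cmod (c m)); [|lra].
          apply Rmult_le_compat; [apply Cmod_ge_0 | | apply Hu | apply Rinv_le_contravar; auto].
          left; apply Rinv_0_lt_compat, Cmod_gt_0, Hc0.
      + exists 1; split; [lra|]; exact (converges_of_sums_on f G HG).
    - rewrite HAf; now apply converges_of_sums_on with F.
    - rewrite HAf; now apply disk_norm_le with F. }
  pose proof (Rbar_le_trans _ _ _ (rsum_le_majorant r f (m + N) (proj1 Hr)) Hmaj) as H.
  simpl Rbar_le in H; rewrite rsum_add in H.
  assert (0 <= rsum (fun n => Cmod (f n) * r ^ n) m)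
    by (apply rsum_nonneg; intros; apply majorant_terms_nonneg; lra).
  apply Rle_trans with (rsum (fun k => Cmod (f (m + k)%nat) * r ^ (m + k)) N); [|lra].
  apply rsum_le; intros k _.
  unfold f; rewrite shift_add, Cmod_div by apply Hc0; lra.
Qed.

Theorem theorem8 (m : nat) (a b c : nat -> C)
  (Hf : pseries_from m a) (Hg : pseries_from m b) (Hh : pseries_from m c)
  (Hc : forall n : nat, (m <= n)%nat -> Cmod (c n) <= Cmod (c (S n)))
  (HTf : converges_in_disk (A_op m c a))
  (HTg : converges_in_disk (A_op m c b))
  (Hsub : subordinate (psum (A_op m c a)) (psum (A_op m c b)))
  (R0 : R) (HR0 : is_bohr_radius m c R0)
  (r : R) (Hr : 0 <= r <= R0) :
  Rbar_le (majorant r a) (majorant r (A_op m c b)).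
Proof.
  destruct HR0 as [Hadm _]; destruct Hf as [Ha0 _].
  apply majorant_le; intros N.
  destruct (Ceq_dec (c m) 0) as [Hcm|Hcm].
  (* here r = 0 and the constant term of f vanishes *)
  { destruct (bohr_zero_lead m c R0 Hadm Hcm) as [HR Hm].
    assert (Hr0 : r = 0) by lra.
    apply Rbar_le_trans with 0.
    - rewrite <- (Rmult_0_r (INR N)), <- rsum_const; apply rsum_le; intros [|k] _.
      + rewrite Ha0, Cmod_0 by easy; lra.
      + rewrite Hr0; simpl; lra.
    - exact (rsum_le_majorant r (A_op m c b) 0 (proj1 Hr)). }
  assert (Hmono : forall n p, (m <= n)%nat -> Cmod (c n) <= Cmod (c (n + p)%nat)).
  { intros n p Hn; induction p as [|p IH]; [rewrite Nat.add_0_r; lra|].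
    rewrite Nat.add_succ_r; specialize (Hc (n + p)%nat ltac:(lia)); lra. }
  assert (Hcpos : forall j, 0 < Cmod (c (m + j)%nat)).
  { intros j; specialize (Hmono m j (Nat.le_refl _)); apply Cmod_gt_0 in Hcm; lra. }
  destruct Hsub as [omega [Han [Hom [Hom0 HFG]]]].
  destruct (schwarz omega Han Hom Hom0) as [t [v [phi [Ht [Hfac [Hv [Hphi Hcoef]]]]]]].
  set (d := A_op m c b) in *.
  (* the k-th power of omega is z^k phi^k; shifting the index by k can only increase |c n| *)
  assert (Hinner : forall k, rsum (fun j => Cmod (shift k (fpow v k) j) / Cmod (c (m + j)%nat)
                                            * r ^ (m + j)) N <= r ^ k).
  { intros k.
    assert (Hnn : forall j, 0 <= Cmod (shift k (fpow v k) j) / Cmod (c (m + j)%nat) * r ^ (m + j)).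
    { intros j; apply Rmult_le_pos; [|apply pow_le; lra].
      apply Rdiv_le_0_compat; [apply Cmod_ge_0 | apply Hcpos]. }
    eapply Rle_trans; [apply rsum_mono with (p := (k + N)%nat); [exact Hnn | lia]|].
    rewrite rsum_add.
    apply Rle_trans with (0 + r ^ k * 1); [|lra]; apply Rplus_le_compat.
    - rewrite <- (Rmult_0_r (INR k)), <- rsum_const; apply rsum_le; intros j Hj.
      rewrite shift_lt, Cmod_0 by easy; unfold Rdiv; lra.
    - eapply Rle_trans; [|apply Rmult_le_compat_l; [apply pow_le; lra|]].
      2:{ apply (bohr_preimage m c (fpow v k) (fun z => phi z ^ k)%C R0 r N Hadm Hr Hcm); auto.
          - now apply sums_on_fpow.
          - intros z Hz; rewrite Cmod_pow, <- (pow1 k); apply pow_incr.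
            split; [apply Cmod_ge_0 | auto]. }
      rewrite <- rsum_scal; apply rsum_le; intros i _.
      rewrite shift_add.
      replace (r ^ (m + (k + i))) with (r ^ k * r ^ (m + i)) by (rewrite <- pow_add; f_equal; lia).
      replace (m + (k + i))%nat with (m + i + k)%nat by lia.
      rewrite (Rmult_comm _ (r ^ k * _)), Rmult_assoc, (Rmult_comm (r ^ (m + i))).
      apply Rmult_le_compat_l; [apply pow_le; lra|].
      apply Rmult_le_compat_r; [apply pow_le; lra|].
      apply Rmult_le_compat_l; [apply Cmod_ge_0|].
      apply Rinv_le_contravar; [apply Hcpos | apply Hmono; lia]. }
  apply Rbar_le_trans with (rsum (fun k => Cmod (d k) * r ^ k) N); [|apply rsum_le_majorant; lra].
  simpl Rbar_le.
  eapply Rle_trans; [apply rsum_mono with (p := (m + N)%nat);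
                     [intros; apply majorant_terms_nonneg; lra | lia]|].
  rewrite rsum_add.
  replace (rsum (fun n => Cmod (a n) * r ^ n) m) with 0.
  2:{ apply Rle_antisym; [apply rsum_nonneg; intros; apply majorant_terms_nonneg; lra|].
      rewrite <- (Rmult_0_r (INR m)), <- rsum_const; apply rsum_le; intros k Hk.
      rewrite Ha0, Cmod_0 by easy; lra. }
  rewrite Rplus_0_l.
  apply Rle_trans with (rsum (fun j => rsum (fun k => Cmod (d k)
      * (Cmod (shift k (fpow v k) j) / Cmod (c (m + j)%nat) * r ^ (m + j))) N) N).
  - apply rsum_le; intros j Hj.
    assert (Ecoef : (c (m + j)%nat * a (m + j)%nat)%C
                    = csum (fun k => d k * shift k (fpow v k) j)%C N).
    { rewrite (Nat.add_comm m j).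
      change (A_op m c a j = csum (fun k => d k * shift k (fpow v k) j)%C N).
      apply (composition_coeff (Rmin t 1) _ d v (psum (A_op m c a)) (psum d) phi);
        auto using sums_on_psum.
      - apply Rmin_pos; lra.
      - intros z Hz; pose proof (Rmin_l t 1); pose proof (Rmin_r t 1).
        rewrite HFG, Hfac by lra; easy. }
    apply (f_equal Cmod) in Ecoef; rewrite Cmod_mult in Ecoef.
    pose proof (Cmod_csum (fun k => d k * shift k (fpow v k) j)%C N) as B.
    rewrite <- Ecoef in B; specialize (Hcpos j).
    set (rc := r ^ (m + j) / Cmod (c (m + j)%nat)).
    assert (Hrc : 0 <= rc) by (apply Rdiv_le_0_compat; [apply pow_le; lra | easy]).
    apply Rle_trans with (rc * rsum (fun k => Cmod (d k * shift k (fpow v k) j)) N).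
    + apply Rle_trans with (rc * (Cmod (c (m + j)%nat) * Cmod (a (m + j)%nat))).
      * right; unfold rc; field; lra.
      * now apply Rmult_le_compat_l.
    + rewrite <- rsum_scal; apply rsum_le; intros k _.
      rewrite Cmod_mult; right; unfold rc; field; lra.
  - rewrite rsum_swap; apply rsum_le; intros k _.
    rewrite rsum_scal; apply Rmult_le_compat_l; [apply Cmod_ge_0 | apply Hinner].
Qed.
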